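(* For every $\varepsilon>0$ there exists $\zeta>0$ such that the following holds. Let $(p_n,q_n)_{n\ge0}$ and $(p'_n,q'_n)_{n\ge0}$ be sequences with $p_n,q_n,p'_n,q'_n\in[0,1]$ and $\sup_{n}\max\{|p_n-p'_n|,|q_n-q'_n|\}<\zeta$, and let $\mu,\mu'$ be the corresponding measures defined by the non-homogeneous Markov rule. Then $|\dim_*(\mu)-\dim_*(\mu')|<\varepsilon$ and $|\mathrm{Dim}_*(\mu)-\mathrm{Dim}_*(\mu')|<\varepsilon$. In other words, $|\dim_*(\mu)-\dim_*(\mu')|$ and $|\mathrm{Dim}_*(\mu)-\mathrm{Dim}_*(\mu')|$ tend to $0$ as $\|(p_n,q_n)_n-(p'_n,q'_n)_n\|_\infty\to0$.
   Context: $\mathbb K=\{0,1\}^{\mathbb N}$ with the metric in which the cylinder $I_{\epsilon_1\dots\epsilon_n}$ has diameter $2^{-n}$; $\mathcal F_n$ is the set of cylinders of generation $n$. Given $(p_n,q_n)_{n\ge0}$ with $0\le p_n,q_n\le 1$, the measure $\mu$ is the Borel probability measure on $\mathbb K$ with $\mu(I_0)=p_0$, $\mu(I_1)=1-p_0$ and, for $n\ge1$, $I=I_{\epsilon_1\dots\epsilon_n}$, $IJ=I_{\epsilon_1\dots\epsilon_n\epsilon_{n+1}}$: $\mu(IJ)/\mu(I)=p_n$ if $(\epsilon_n,\epsilon_{n+1})=(0,0)$, $1-p_n$ if $(0,1)$, $q_n$ if $(1,0)$, $1-q_n$ if $(1,1)$. $\dim_*(\mu)=\inf\{\dim_{\mathcal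 H}E: E\subset\mathbb K,\ \mu(E)>0\}$ and $\mathrm{Dim}_*(\mu)=\inf\{\dim_{\mathcal P}E: E\subset\mathbb K,\ \mu(E)>0\}$, with $\dim_{\mathcal H}$ the Hausdorff and $\dim_{\mathcal P}$ the packing dimension. *)

(* Defs.v *)
From HB Require Import structures.
From mathcomp Require Import all_boot all_order all_algebra.
From mathcomp Require Import all_classical all_reals all_analysis.
Set Implicit Arguments. Unset Strict Implicit. Unset Printing Implicit Defensive.
Import Order.TTheory GRing.Theory Num.Theory.
Local Open Scope classical_set_scope.
Local Open Scope ring_scope.

(* The Cantor space K = {0,1}^N ; 0 is [false], 1 is [true]. *)
Definition K := nat -> bool.

Definition cyl (w : seq bool) : set K :=
  [set x | forall i, (i < size w)%N -> x i = nth false w i].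

Definition cylinders : set (set K) := [set cyl w | w in [set: seq bool]].

(* Measurable structure on K: the sigma-algebra generated by the cylinders,
   i.e. the Borel sigma-algebra of K. *)
Definition KM := g_sigma_algebraType cylinders.

Section Dims.
Variable R : realType.

(* Metric: d(x,y) = 2^{-n} where n is the first index where x and y differ
   (0-indexed), so that the cylinder of generation n has diameter 2^{-n}. *)
Definition dist (x y : K) : R :=
  match pselect (exists n, x n != y n) with
  | left h => (2%:R ^- (ex_minn h))
  | right _ => 0
  end.

(* Diameter (diam of the empty set is 0). *)
Definition diam (E : set K) : R :=
  fine (ereal_sup ([set (dist xy.1 xy.2)%:E | xy in E `*` E] `|` [set 0%:E])).

Definition hausdorff_delta (s delta : R) (E : set K) : \bar R :=
  ereal_inf [set (\sum_(i <oo) ((diam (U i)) `^ s)%:E)%E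
            | U in [set U : nat -> set K | E `<=` \bigcup_i U i /\
                                           forall i, diam (U i) <= delta]].

Definition hausdorff (s : R) (E : set K) : \bar R :=
  ereal_sup [set hausdorff_delta s delta E | delta in [set d : R | 0 < d]].

Definition dimH (E : set K) : \bar R :=
  ereal_inf [set s%:E | s in [set s : R | 0 < s /\ hausdorff s E = 0%E]].

Definition cball (x : K) (r : R) : set K := [set y | dist x y <= r].

(* delta-packings of E: countable families of pairwise disjoint closed balls
   B(x_i, r_i) with centres x_i in E and radii 0 < r_i <= delta; indices with
   r_i = 0 are dummy entries (they contribute 0 and impose no constraint),
   which encodes finite families. *)
Definition is_delta_packing (delta : R) (E : set K) (x : nat -> K) (r : nat -> R) :=
  (forall i, E (x i)) /\ (forall i, 0 <= r i <= delta) /\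
  (forall i j, i <> j -> 0 < r i -> 0 < r j ->
     cball (x i) (r i) `&` cball (x j) (r j) = set0).

Definition packing_delta (s delta : R) (E : set K) : \bar R :=
  ereal_sup ([set (\sum_(i <oo) ((2 * xr.2 i) `^ s)%:E)%E
             | xr in [set xr : (nat -> K) * (nat -> R) |
                        is_delta_packing delta E xr.1 xr.2]]
             `|` [set 0%E]).

(* Packing premeasure P_0^s = lim_{delta -> 0} P_delta^s (a decreasing limit). *)
Definition packing_pre (s : R) (E : set K) : \bar R :=
  ereal_inf [set packing_delta s delta E | delta in [set d : R | 0 < d]].

Definition packing (s : R) (E : set K) : \bar R :=
  ereal_inf [set (\sum_(i <oo) packing_pre s (F i))%E
            | F in [set F : nat -> set K | E `<=` \bigcup_i F i]].

Definition dimP (E : set K) : \bar R :=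
  ereal_inf [set s%:E | s in [set s : R | 0 < s /\ packing s E = 0%E]].

Definition lower_dimH (mu : set KM -> \bar R) : \bar R :=
  ereal_inf [set dimH E | E in [set E : set KM | measurable E /\ (0 < mu E)%E]].

Definition lower_dimP (mu : set KM -> \bar R) : \bar R :=
  ereal_inf [set dimP E | E in [set E : set KM | measurable E /\ (0 < mu E)%E]].

Definition trans (a b : R) (prev cur : bool) : R :=
  if ~~ prev then (if ~~ cur then a else 1 - a)
  else (if ~~ cur then b else 1 - b).

(* Mass assigned to the cylinder of the word w = [:: e_1; ...; e_n]:
   mu(I_0) = p_0, mu(I_1) = 1 - p_0, and the factor for e_{k+1} given e_k
   uses (p_k, q_k). (0-indexed: position i >= 1 of w uses p_i, q_i.) *)
Definition markov_mass (p q : nat -> R) (w : seq bool) : R :=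
  \prod_(i < size w)
    (if i == 0%N :> nat then (if nth false w 0 then 1 - p 0%N else p 0%N)
     else trans (p i) (q i) (nth false w i.-1) (nth false w i)).

Definition is_markov_measure (p q : nat -> R) (mu : {measure set KM -> \bar R}) :=
  forall w : seq bool, mu (cyl w) = (markov_mass p q w)%:E.

End Dims.

(* Main.v *)
(** The mass of a cylinder is the law of a two-state Markov chain, so its
    information [- ln (mu I_n(x))] has mean [H n], the entropy of [n] steps.
    If [t = 1 - `|p k - q k|], one step contracts the dependence on the current
    state by [1 - t], while the entropies of the two rows differ by at most
    [4 * sqrt t]: a chain that mixes slowly carries little entropy.  Balancing
    the two by the AM-GM inequality gives three things at once: the means
    started from the two states differ by [O(sqrt n)], the information of [n]
    steps has variance [O(n ^ (3/2))], and a perturbation of the weights of size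
    [zeta] moves [H n] by at most [9 * n * sqrt zeta].

    Chebyshev's inequality along [n = m ^ 4], with the monotonicity of the mass
    in between, shows that the information is asymptotic to [H n] almost surely.
    Covering and packing arguments then identify [lower_dimH mu] with the lower
    limit and [lower_dimP mu] with the upper limit of [H n / (n * ln 2)]. *)

Require Import Defs.
From HB Require Import structures.
From mathcomp Require Import all_boot all_order all_algebra.
From mathcomp Require Import all_classical all_reals all_analysis.
From mathcomp Require Import ring lra.
Set Implicit Arguments.
Unset Strict Implicit.
Import Order.TTheory GRing.Theory Num.Theory.
Local Open Scope classical_set_scope.
Local Open Scope ring_scope.

(** * Entropy of one step *)

Section Entropy.
Context {R : realType}.
Implicit Types x y : R.

Lemma ln_le_subr1 x : 0 < x -> ln x <= x - 1.
Proof.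
move=> x0; have := expR_ge1Dx (ln x); rewrite lnK ?posrE//; lra.
Qed.

Lemma ln_le0_01 x : 0 <= x <= 1 -> ln x <= 0.
Proof. by case/andP=> _ x1; exact: ln_le0. Qed.

(** Put [y = sqrt x], so that [ln x = 2 * ln y], and multiply [- ln y <= y^-1 - 1] by
    [2 * y ^+ 2]. *)
Lemma Nxlnx_le_sqrt x : 0 <= x <= 1 -> - (x * ln x) <= 2 * Num.sqrt x.
Proof.
case/andP; rewrite le_eqVlt => /predU1P[<- _|x0 x1].
  by rewrite mul0r oppr0 sqrtr0 mulr0.
set y := Num.sqrt x; have y0 : 0 < y by rewrite sqrtr_gt0.
have xE : x = y ^+ 2 by rewrite sqr_sqrtr// ltW.
have := @ln_le_subr1 y^-1; rewrite invr_gt0 => /(_ y0); rewrite lnV ?posrE// => H.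
have lnE : ln x = 2 * ln y by rewrite xE expr2 lnM ?posrE//; lra.
have yV : y * y^-1 = 1 by rewrite divff// gt_eqF.
rewrite lnE {1}xE; have : y ^+ 2 * (y^-1 - 1 + ln y) >= 0.
  by rewrite mulr_ge0 ?sqr_ge0//; lra.
rewrite !mulrDr expr2 -mulrA yV; nra.
Qed.

(** With [y = sqrt x] the left side is [4 * (y * ln y) ^+ 2], and [- (y * ln y)] lies in [0, 1].
    This will bound the second moment of the information of one step. *)
Lemma xlnx2_le x : 0 <= x <= 1 -> x * ln x ^+ 2 <= 4.
Proof.
case/andP; rewrite le_eqVlt => /predU1P[<- _|x0 x1].
  by rewrite mul0r.
set y := Num.sqrt x; have y0 : 0 < y by rewrite sqrtr_gt0.
have xE : x = y ^+ 2 by rewrite sqr_sqrtr// ltW.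
have y1 : y <= 1 by rewrite -sqrtr1 ler_sqrt.
have := @ln_le_subr1 y^-1; rewrite invr_gt0 => /(_ y0); rewrite lnV ?posrE// => H.
have lnE : ln x = 2 * ln y by rewrite xE expr2 lnM ?posrE//; lra.
have ly : ln y <= 0 by exact: ln_le0.
have yV : y * y^-1 = 1 by rewrite divff// gt_eqF.
have : y * (y^-1 - 1 + ln y) >= 0 by rewrite mulr_ge0 ?(ltW y0)//; lra.
rewrite !mulrDr yV => K1.
have K2 : 0 <= - (y * ln y) <= 1 by apply/andP; split; nra.
rewrite lnE {1}xE.
have -> : y ^+ 2 * (2 * ln y) ^+ 2 = 4 * (- (y * ln y)) ^+ 2 by ring.
rewrite -[X in _ <= X]mulr1 ler_pM2l//.
by case/andP: K2 => ? ?; rewrite expr_le1.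
Qed.

(** Write the difference as [(y - x) * ln y + x * (ln y - ln x)]. The first term lies between
    [(y - x) * ln (y - x)] and 0, the second between 0 and [y - x]. *)
Lemma xlnx_modulus x y : 0 <= x -> x <= y -> y <= 1 ->
  `|y * ln y - x * ln x| <= 2 * Num.sqrt (y - x).
Proof.
move=> x0; rewrite le_eqVlt => /predU1P[->|xy] y1.
  by rewrite !subrr normr0 sqrtr0 mulr0.
have y0 : 0 < y by lra.
have d1 : 0 <= y - x <= 1 by lra.
have H := @Nxlnx_le_sqrt _ d1.
have dsq : y - x <= Num.sqrt (y - x).
  have : Num.sqrt (y - x) <= 1 by rewrite -sqrtr1 ler_sqrt//; lra.
  have := sqrtr_ge0 (y - x); have := @sqr_sqrtr _ (y - x); nra.
have ly : ln y <= 0 by exact: ln_le0.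
have lyx : ln (y - x) <= ln y by rewrite ler_ln ?posrE//; lra.
have [x00|xp] := leP x 0.
  have -> : x = 0 by lra.
  move: H; have -> : x = 0 by lra.
  rewrite subr0 mul0r subr0 => H; rewrite ler0_norm//; nra.
have lxy : ln x <= ln y by rewrite ler_ln ?posrE//; lra.
have K : x * (ln y - ln x) <= y - x.
  have := @ln_le_subr1 (y / x); rewrite divr_gt0// => /(_ isT).
  rewrite ln_div ?posrE// => K.
  have -> : y - x = x * (y / x - 1) by field; rewrite gt_eqF.
  by rewrite ler_pM2l.
rewrite ler_norml; apply/andP; split; nra.
Qed.

(** Shannon entropy, in nats, of a coin of bias [x]. *)
Definition ent x := - (x * ln x) - (1 - x) * ln (1 - x).

(** Each of the two terms of [ent] contributes [2 * sqrt]. This exponent 1/2 is the origin of the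
    [sqrt zeta] and [sqrt n] in the later bounds. *)
Lemma ent_modulus x y : 0 <= x <= 1 -> 0 <= y <= 1 ->
  `|ent x - ent y| <= 4 * Num.sqrt `|x - y|.
Proof.
wlog xy : x y / x <= y => [hw x1 y1|/andP[x0 x1] /andP[y0 y1]].
  have [xy|/ltW yx] := leP x y; first exact: hw.
  by rewrite distrC (distrC x); exact: hw.
have := @xlnx_modulus x y x0 xy y1.
have := @xlnx_modulus (1 - y) (1 - x); rewrite !subr_ge0 y1 => /(_ isT).
have -> : (1 - y <= 1 - x) = true by lra.
have -> : (1 - x <= 1) = true by lra.
move=> /(_ isT isT); have -> : 1 - x - (1 - y) = y - x by ring.
rewrite (distrC (ent x)) (distrC x) [`|y - x|]ger0_norm ?subr_ge0// /ent.
set A := (1 - x) * ln (1 - x) - _; set B := y * ln y - x * ln x => HA HB.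
have -> : - (y * ln y) - (1 - y) * ln (1 - y) - (- (x * ln x) - (1 - x) * ln (1 - x))
  = A - B by rewrite /A /B; ring.
apply: (le_trans (ler_normB _ _)); lra.
Qed.

Lemma ent0 : ent 0 = 0. Proof. by rewrite /ent mul0r subr0 ln1 mulr0 subr0 oppr0. Qed.

Lemma ent1 : ent 1 = 0. Proof. by rewrite /ent subrr mul0r ln1 mulr0 subr0 oppr0. Qed.

Lemma ent_ge0 x : 0 <= x <= 1 -> 0 <= ent x.
Proof.
move=> x01; have : ln x <= 0 by exact: ln_le0_01.
have : ln (1 - x) <= 0 by apply: ln_le0_01; lra.
rewrite /ent; nra.
Qed.

Lemma ent_le4 x : 0 <= x <= 1 -> ent x <= 4.
Proof.
move=> x01; have := @ent_modulus x 0 x01; rewrite lexx ler01 => /(_ isT).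
rewrite ent0 !subr0 => H; apply: (le_trans (ler_norm _)); apply: (le_trans H).
have : Num.sqrt `|x| <= 1 by rewrite -sqrtr1 ler_sqrt// ger0_norm; lra.
lra.
Qed.

Lemma trans01 a b c d : 0 <= a <= 1 -> 0 <= b <= 1 -> 0 <= @trans R a b c d <= 1.
Proof. by rewrite /trans; case: c; case: d => /= *; lra. Qed.

End Entropy.

(** * The chain and its mean information *)

Fixpoint words n : seq (seq bool) :=
  if n is n'.+1 then map (cons false) (words n') ++ map (cons true) (words n')
  else [:: [::]].

Lemma mem_words n w : (w \in words n) = (size w == n).
Proof.
elim: n w => [|n IH] [|b w] //=.
  by rewrite mem_cat; apply/negbTE/norP; split; apply/mapP => -[].
have consI b' : injective (cons b' : seq bool -> _) by move=> ? ? [].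
rewrite mem_cat eqSS -IH; case: b.
  by rewrite [X in _ || X]mem_map// (_ : _ \in _ = false)//; apply/mapP => -[].
by rewrite mem_map// orbC (_ : _ \in _ = false)//; apply/mapP => -[].
Qed.

Lemma words_uniq n : uniq (words n).
Proof.
elim: n => //= n IH; rewrite cat_uniq !map_inj_uniq ?IH; try by move=> ? ? [].
by rewrite andbT/=; apply/hasPn => w /mapP[w' _ ->]; apply/mapP => -[].
Qed.

Section Chain.
Context {R : realType}.
Implicit Types (p q : nat -> R) (u : R).

(* The chain started at time [k] in state [a]; [markov_mass] is the case
   [k = 0], [a = false], since [trans (p 0) _ false] is the initial law. *)
Fixpoint chain_mass p q k a (w : seq bool) : R :=
  if w is b :: w' then trans (p k) (q k) a b * chain_mass p q k.+1 b w' else 1.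

(** Summed step by step, with [ln 0 = 0]: it is finite on words of mass 0 too, but need not be minus
    the logarithm of the mass there. *)
Fixpoint info p q k a (w : seq bool) : R :=
  if w is b :: w' then - ln (trans (p k) (q k) a b) + info p q k.+1 b w' else 0.

(* Expected information of [n] steps from time [k], [u] being the probability
   of state 0 at time [k]. *)
Fixpoint mean p q k u n : R :=
  if n is n'.+1 then
    u * ent (p k) + (1 - u) * ent (q k)
      + mean p q k.+1 (u * p k + (1 - u) * q k) n'
  else 0.

Lemma markov_massE p q w : markov_mass p q w = chain_mass p q 0 false w.
Proof.
(* The induction needs an arbitrary start. With [a] put in front of [w], the predecessor of letter
   [i] is entry [i] of [a :: w], and the first letter is no special case. *)
suff H k a : chain_mass p q k a w = \prod_(i < size w)
    trans (p (k + i)%N) (q (k + i)%N) (nth false (a :: w) i) (nth false w i).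
  rewrite H /markov_mass; apply: eq_bigr => -[[|i] Hi] _ //=.
  by rewrite /trans /=; case: nth.
elim: w k a => [|b w IH] k a; first by rewrite big_ord0.
rewrite /= big_ord_recl /= addn0 IH; congr (_ * _); apply: eq_bigr => i _.
by rewrite /= /bump /= add1n addSnnS.
Qed.

Lemma big_wordsS n (F : seq bool -> R) :
  \sum_(w <- words n.+1) F w =
  \sum_(w <- words n) F (false :: w) + \sum_(w <- words n) F (true :: w).
Proof. by rewrite big_cat /= !big_map. Qed.

Section OneChain.
Variables p q : nat -> R.
Hypothesis p01 : forall n, 0 <= p n <= 1.
Hypothesis q01 : forall n, 0 <= q n <= 1.

Lemma chain_mass01 k a w : 0 <= chain_mass p q k a w <= 1.
Proof.
elim: w k a => [|b w IH] k a /=; first by rewrite ler01 lexx.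
have /andP[h1 h2] := IH k.+1 b.
have /andP[h3 h4] := @trans01 _ _ _ a b (p01 k) (q01 k).
by rewrite mulr_ge0//= mulr_ile1.
Qed.

Lemma infoE k a w : 0 < chain_mass p q k a w ->
  info p q k a w = - ln (chain_mass p q k a w).
Proof.
elim: w k a => [|b w IH] k a /=; first by rewrite ln1 oppr0.
have /andP[h1 h2] := chain_mass01 k.+1 b w.
have /andP[h3 h4] := @trans01 _ _ _ a b (p01 k) (q01 k) => h.
have c0 : 0 < chain_mass p q k.+1 b w by nra.
have t0 : 0 < trans (p k) (q k) a b by nra.
by rewrite IH// lnM// opprD.
Qed.

Lemma chain_mass_take k a w n :
  chain_mass p q k a w <= chain_mass p q k a (take n w).
Proof.
elim: w k a n => [|b w IH] k a [|n] //=; first by have /andP[] := chain_mass01 k a (b :: w).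
by rewrite ler_wpM2l//; have /andP[] := @trans01 _ _ _ a b (p01 k) (q01 k).
Qed.

Lemma sum_chain_mass k a n : \sum_(w <- words n) chain_mass p q k a w = 1.
Proof.
elim: n k a => [|n IH] k a; first by rewrite big_seq1.
rewrite big_wordsS -!mulr_sumr !IH !mulr1 /trans; case: a => /=; ring.
Qed.

(** Both the entropy of a step and the law after it are affine in the law before it. So only the two
    deterministic starts matter. *)
Lemma mean_affine k u n :
  mean p q k u n = u * mean p q k 1 n + (1 - u) * mean p q k 0 n.
Proof.
elim: n k u => [|n IH] k u /=; first by rewrite !mulr0 addr0.
rewrite (IH k.+1 (u * _ + _)) (IH k.+1 (1 * _ + _)) (IH k.+1 (0 * _ + _)); ring.
Qed.

Lemma mean_ge0 k u n : 0 <= u <= 1 -> 0 <= mean p q k u n.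
Proof.
elim: n k u => [|n IH] k u u01 //=.
have [? ?] := (ent_ge0 (p01 k), ent_ge0 (q01 k)); have := p01 k; have := q01 k.
by move=> ? ?; rewrite !addr_ge0 ?mulr_ge0 ?IH//; try lra; apply/andP; split; nra.
Qed.

Lemma mean_le k u n : 0 <= u <= 1 -> mean p q k u n <= n%:R * 4.
Proof.
elim: n k u => [|n IH] k u u01 /=; first by rewrite mul0r.
have := ent_le4 (p01 k); have := ent_le4 (q01 k); have := p01 k; have := q01 k.
move=> hq hp ? ?; have := @IH k.+1 (u * p k + (1 - u) * q k).
have -> : 0 <= u * p k + (1 - u) * q k <= 1 by apply/andP; split; nra.
by move=> /(_ isT); rewrite -natr1; nra.
Qed.

End OneChain.

(** Expand the square of [z - 2 * sqrt t]. The root is traded for a term linear in [t], which a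
    contraction by [1 - t] can absorb. *)
Lemma sqrt_amgm (t z : R) : 0 <= t -> 0 < z -> 4 * Num.sqrt t <= z + 4 * t / z.
Proof.
move=> t0 z0; rewrite -(ler_pM2r z0).
have -> : (z + 4 * t / z) * z = z ^+ 2 + 4 * t by field; rewrite gt_eqF.
have := sqr_sqrtr t0; have := sqr_ge0 (z - 2 * Num.sqrt t); nra.
Qed.

(* The law [u] of the state contracts by [1 - t] with [t = 1 - `|p k - q k|],
   while the entropies of the two rows differ by at most [4 * sqrt t]: states
   that are slow to mix carry little entropy. *)
Lemma mean_compare p q p' q' (z : R) : 0 < z ->
  (forall n, 0 <= p n <= 1) -> (forall n, 0 <= q n <= 1) ->
  (forall n, 0 <= p' n <= 1) -> (forall n, 0 <= q' n <= 1) ->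
  (forall n, `|p n - p' n| <= z ^+ 2) -> (forall n, `|q n - q' n| <= z ^+ 2) ->
  forall n k u u', 0 <= u <= 1 -> 0 <= u' <= 1 ->
  `|mean p q k u n - mean p' q' k u' n| <= 4 / z * `|u - u'| + 9 * n%:R * z.
Proof.
move=> z0 p01 q01 p'01 q'01 pz qz; elim=> [|n IH] k u u' u01 u'01 /=.
  rewrite subrr normr0 mulr0 mul0r addr0 mulr_ge0// divr_ge0 ?ltW//.
have c01 (a b v : R) : 0 <= a <= 1 -> 0 <= b <= 1 -> 0 <= v <= 1 ->
    0 <= v * a + (1 - v) * b <= 1.
  by move=> *; apply/andP; split; nra.
have := IH k.+1 _ _ (c01 _ _ _ (p01 k) (q01 k) u01) (c01 _ _ _ (p'01 k) (q'01 k) u'01).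
set M := mean _ _ _ _ _; set M' := mean _ _ _ _ _.
set v := u * p k + _; set v' := u' * p' k + _ => HM.
have entz (x y : R) : 0 <= x <= 1 -> 0 <= y <= 1 -> `|x - y| <= z ^+ 2 ->
    `|ent x - ent y| <= 4 * z.
  move=> x01 y01 xy; apply: (le_trans (ent_modulus x01 y01)).
  rewrite ler_pM2l// -[leRHS]gtr0_norm// -(sqrtr_sqr z).
  by rewrite ler_sqrt// sqr_ge0.
have ep := entz _ _ (p01 k) (p'01 k) (pz k).
have eq := entz _ _ (q01 k) (q'01 k) (qz k).
set t : R := 1 - `|p k - q k|.
have t0 : 0 <= t by rewrite /t subr_ge0 ler_norml; move: (p01 k) (q01 k); lra.
(* A small [t] forces one of [p k], [q k] close to 0 and the other close to 1, and [ent] vanishes at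
   both ends. *)
have epq : `|ent (p k) - ent (q k)| <= z + 4 * t / z.
  apply: le_trans (sqrt_amgm t0 z0).
  have tp (x : R) : 0 <= x <= 1 -> ent x <= 4 * Num.sqrt x /\ ent x <= 4 * Num.sqrt (1 - x).
    move=> x01; split; apply: (le_trans (ler_norm _)).
      have := @ent_modulus _ x 0 x01; rewrite lexx ler01 ent0 !subr0 => /(_ isT).
      by rewrite [`|x|]ger0_norm//; lra.
    have := @ent_modulus _ x 1 x01; rewrite lexx ler01 => /(_ isT).
    by rewrite ent1 subr0 (distrC x) [`|1 - x|]ger0_norm//; lra.
  have [hp1 hp2] := tp _ (p01 k); have [hq1 hq2] := tp _ (q01 k).
  have := ent_ge0 (p01 k); have := ent_ge0 (q01 k) => gq gp.
  have [le|lt] := leP (p k) (q k).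
    have tE : t = 1 - q k + p k by rewrite /t ler0_norm; lra.
    have : Num.sqrt (p k) <= Num.sqrt t by rewrite ler_sqrt// tE; move: (q01 k); lra.
    have : Num.sqrt (1 - q k) <= Num.sqrt t by rewrite ler_sqrt// tE; move: (p01 k); lra.
    by rewrite ler_norml; lra.
  have tE : t = 1 - p k + q k by rewrite /t ger0_norm; lra.
  have : Num.sqrt (q k) <= Num.sqrt t by rewrite ler_sqrt// tE; move: (p01 k); lra.
  have : Num.sqrt (1 - p k) <= Num.sqrt t by rewrite ler_sqrt// tE; move: (q01 k); lra.
  by rewrite ler_norml; lra.
set d := `|u - u'|; have d0 : 0 <= d by exact: normr_ge0.
have vd : `|v - v'| <= (1 - t) * d + z ^+ 2.
  have -> : v - v' = (u - u') * (p k - q k) + (u' * (p k - p' k) + (1 - u') * (q k - q' k)).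
    by rewrite /v /v'; ring.
  apply: (le_trans (ler_normD _ _)); apply: lerD.
    by rewrite normrM /t /d subKr mulrC.
  apply: (le_trans (ler_normD _ _)); rewrite !normrM.
  have -> : `|u'| = u' by rewrite ger0_norm//; lra.
  have -> : `|1 - u'| = 1 - u' by rewrite ger0_norm//; lra.
  by have := pz k; have := qz k; nra.
set A := ent (p k) in ep epq *; set B := ent (q k) in eq epq *.
set A' := ent (p' k) in ep *; set B' := ent (q' k) in eq *.
have first : `|u * A + (1 - u) * B - (u' * A' + (1 - u') * B')| <= d * (z + 4 * t / z) + 4 * z.
  have -> : u * A + (1 - u) * B - (u' * A' + (1 - u') * B') =
    (u - u') * (A - B) + (u' * (A - A') + (1 - u') * (B - B')) by ring.
  apply: (le_trans (ler_normD _ _)); apply: lerD.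
    by rewrite normrM ler_wpM2l.
  apply: (le_trans (ler_normD _ _)); rewrite !normrM.
  have -> : `|u'| = u' by rewrite ger0_norm//; lra.
  have -> : `|1 - u'| = 1 - u' by rewrite ger0_norm//; lra.
  by nra.
have -> : u * A + (1 - u) * B + M - (u' * A' + (1 - u') * B' + M') =
  (u * A + (1 - u) * B - (u' * A' + (1 - u') * B')) + (M - M') by ring.
apply: (le_trans (ler_normD _ _)).
apply: (le_trans (lerD first HM)).
have d1 : d <= 1 by rewrite /d ler_norml; lra.
have zi : 0 < z^-1 by rewrite invr_gt0.
(* The contraction of [4 / z * d] releases [d * (4 * t / z)], exactly the cost of the entropy gap in
   [first]. There remain [4 * z] from [first], [4 * z] from the perturbed law and [d * z <= z]:
   hence the 9. *)
have : 4 / z * `|v - v'| <= 4 / z * ((1 - t) * d + z ^+ 2).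
  by rewrite ler_wpM2l// mulr_ge0// ltW.
have -> : 4 / z * ((1 - t) * d + z ^+ 2) = 4 / z * d - d * (4 * t / z) + 4 * z.
  by field; rewrite gt_eqF.
rewrite -natr1 mulrDr mulr1 mulrDr; nra.
Qed.

End Chain.

(** * Variance of the information *)

Section Variance.
Context {R : realType}.
Variables p q : nat -> R.
Hypothesis p01 : forall n, 0 <= p n <= 1.
Hypothesis q01 : forall n, 0 <= q n <= 1.

(** [mean] takes the probability of state 0, that is of [false]; hence the negation. *)
Definition state_mean k (a : bool) n := mean p q k (~~ a)%:R n.

Definition info_var k a n : R :=
  \sum_(w <- words n) chain_mass p q k a w * (info p q k a w - state_mean k a n) ^+ 2.

Lemma state_meanS k a n : state_mean k a n.+1 =
  \sum_(b : bool) trans (p k) (q k) a b *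
    (- ln (trans (p k) (q k) a b) + state_mean k.+1 b n).
Proof.
rewrite big_bool /state_mean /=.
rewrite [mean _ _ _ ((~~ a)%:R * _ + _) _]mean_affine /ent /trans; case: a => /=; ring.
Qed.

(** Identifies [mean], defined by a recursion on laws, with an expectation over words. *)
Lemma sum_info k a n :
  \sum_(w <- words n) chain_mass p q k a w * info p q k a w = state_mean k a n.
Proof.
elim: n k a => [|n IH] k a; first by rewrite big_seq1 mulr0.
have E b : \sum_(w <- words n) chain_mass p q k a (b :: w) * info p q k a (b :: w) =
    trans (p k) (q k) a b * (- ln (trans (p k) (q k) a b) + state_mean k.+1 b n).
  under eq_bigr => w _ do rewrite /= -mulrA mulrDr.
  by rewrite -mulr_sumr big_split /= -mulr_suml sum_chain_mass// mul1r IH.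
by rewrite big_wordsS !E state_meanS big_bool addrC.
Qed.

(* Law of total variance for the first step. *)
Lemma info_varS k a n : info_var k a n.+1 =
  \sum_(b : bool) trans (p k) (q k) a b * (info_var k.+1 b n +
    (- ln (trans (p k) (q k) a b) + state_mean k.+1 b n - state_mean k a n.+1) ^+ 2).
Proof.
have E b : \sum_(w <- words n) chain_mass p q k a (b :: w) *
    (info p q k a (b :: w) - state_mean k a n.+1) ^+ 2 =
    trans (p k) (q k) a b * (info_var k.+1 b n +
    (- ln (trans (p k) (q k) a b) + state_mean k.+1 b n - state_mean k a n.+1) ^+ 2).
  set c := - ln _ + _ - _; set m := state_mean k.+1 b n.
  (* The information of the tail is centred at its own mean [m], so the cross term with factor
     [2 * c] sums to 0. *)
  transitivity (\sum_(w <- words n) trans (p k) (q k) a b *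
     (chain_mass p q k.+1 b w * (info p q k.+1 b w - m) ^+ 2
     + c ^+ 2 * chain_mass p q k.+1 b w
     + 2 * c * (chain_mass p q k.+1 b w * info p q k.+1 b w
                - m * chain_mass p q k.+1 b w))).
    by apply: eq_bigr => w _ /=; rewrite /c -/m; ring.
  rewrite -mulr_sumr !big_split /= -!mulr_sumr big_split /= sumrN -mulr_sumr.
  by rewrite sum_info !sum_chain_mass// /m; congr (_ * _); rewrite /info_var; ring.
by rewrite /info_var big_wordsS !E big_bool addrC.
Qed.

(** Compare the chain with itself, started from its two states, at [z = 1 / sqrt N]: then
    [4 / z + 9 * n * z] is at most [(4 + 9) * sqrt N]. *)
Lemma mean_gap N n k : (0 < N)%N -> (n <= N)%N ->
  `|state_mean k false n - state_mean k true n| <= 13 * Num.sqrt N%:R.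
Proof.
move=> N0 nN; set z := Num.sqrt N%:R.
have z0 : 0 < z by rewrite sqrtr_gt0 ltr0n.
have zz : z ^+ 2 = N%:R by rewrite sqr_sqrtr// ler0n.
have zi : 0 < z^-1 by rewrite invr_gt0.
have h0 (f : nat -> R) i : `|f i - f i| <= z^-1 ^+ 2 by rewrite subrr normr0 sqr_ge0.
have := @mean_compare _ p q p q z^-1 zi p01 q01 p01 q01 (h0 p) (h0 q) n k 1 0.
rewrite /state_mean /= !lexx ler01 => /(_ isT isT) /le_trans; apply.
rewrite subr0 normr1 mulr1 invrK.
have : n%:R * z^-1 <= z.
  by rewrite ler_pdivrMr// -expr2 zz ler_nat.
lra.
Qed.

Lemma state_gapS k n :
  `|state_mean k false n.+1 - state_mean k true n.+1| <=
  4 + `|p k - q k| * `|state_mean k.+1 false n - state_mean k.+1 true n|.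
Proof.
rewrite -normrM /state_mean /=.
rewrite (mean_affine _ _ _ (1 * _ + _)) (mean_affine _ _ _ (0 * _ + _)).
set M1 := mean _ _ _ 1 _; set M0 := mean _ _ _ 0 _.
rewrite [X in `|X|](_ : _ = (ent (p k) - ent (q k)) + (p k - q k) * (M1 - M0)); last by ring.
apply: (le_trans (ler_normD _ _)); rewrite lerD2r.
have := ent_ge0 (p01 k); have := ent_ge0 (q01 k).
have := ent_le4 (p01 k); have := ent_le4 (q01 k).
by rewrite ler_norml; lra.
Qed.

(** The gap between the two state means serves as a potential. A step adds to the variance at most a
    constant plus [2 * B * t * D'], while the potential [2 * B * D'] shrinks by that amount, up to
    the [8 * B] coming from the entropies of the step. *)
Lemma info_var_bound (B : R) N : 0 <= B ->
  (forall n k, (n <= N)%N -> `|state_mean k false n - state_mean k true n| <= B) ->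
  forall n k a, (n <= N)%N ->
  info_var k a n + 2 * B * `|state_mean k false n - state_mean k true n|
    <= n%:R * (16 + 8 * B).
Proof.
move=> B0 HB; elim=> [|n IH] k a nN.
  by rewrite /info_var big_seq1 /= /state_mean /= !subrr normr0 mulr0 expr0n /= mulr0 addr0 mul0r.
have nN' : (n <= N)%N by exact: ltnW.
set D := `|_ - _|; have HD : D <= _ := state_gapS k n.
set D' := `|state_mean k.+1 false n - state_mean k.+1 true n| in HD *.
have D'B : D' <= B by exact: HB.
have D'0 : 0 <= D' by exact: normr_ge0.
have IHf := IH k.+1 false nN'; have IHt := IH k.+1 true nN'; rewrite -/D' in IHf IHt.
rewrite info_varS state_meanS !big_bool /=.
have D'sq : (state_mean k.+1 false n - state_mean k.+1 true n) ^+ 2 = D' ^+ 2.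
  by rewrite real_normK// num_real.
set m0 := state_mean k.+1 false n in D'sq *; set m1 := state_mean k.+1 true n in D'sq *.
set V0 := info_var k.+1 false n in IHf *; set V1 := info_var k.+1 true n in IHt *.
pose t : R := 1 - `|p k - q k|.
have tE : `|p k - q k| = 1 - t by rewrite /t subKr.
rewrite tE in HD.
pose x := trans (p k) (q k) a false.
have x01 : 0 <= x <= 1 by exact: trans01.
have -> : trans (p k) (q k) a true = 1 - x by rewrite /x /trans; case: (a).
rewrite -/x; set f0 := ln x; set f1 := ln (1 - x).
have h0 : x * f0 ^+ 2 <= 4 := xlnx2_le x01.
have h1 : (1 - x) * f1 ^+ 2 <= 4 by apply: xlnx2_le; lra.
(* The link between noise and mixing: a step whose outcome is uncertain must also contract. *)
have xt : x * (1 - x) <= t.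
  have xE : x = p k \/ x = q k by rewrite /x /trans; case: (a); [right|left].
  have := p01 k; have := q01 k; rewrite /t.
  have [?|?] := leP (p k) (q k); [rewrite ler0_norm; last lra|rewrite ger0_norm; last lra];
    by case: xE => -> ? ?; nra.
have tB : t * D' ^+ 2 <= B * (t * D').
  have tD0 : 0 <= t * D' by rewrite mulr_ge0//; apply: le_trans xt; nra.
  by rewrite expr2; nra.
set LHS := (X in X + _ <= _).
(* A variable with two values taken with probabilities [x] and [1 - x] has variance [x * (1 - x)]
   times the squared difference of the values. *)
have -> : LHS = x * V0 + (1 - x) * V1 +
   x * (1 - x) * ((f0 - f1) - (m0 - m1)) ^+ 2 by rewrite /LHS; ring.
have h2 : x * (1 - x) * (f0 - f1) ^+ 2 <= 8.
  have -> : x * (1 - x) * (f0 - f1) ^+ 2 = x * f0 ^+ 2 + (1 - x) * f1 ^+ 2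
    - (x * f0 + (1 - x) * f1) ^+ 2 by ring.
  by have := sqr_ge0 (x * f0 + (1 - x) * f1); lra.
have h3 : x * (1 - x) * (m0 - m1) ^+ 2 <= B * (t * D').
  by rewrite D'sq; apply: le_trans tB; rewrite ler_wpM2r// sqr_ge0.
have xx0 : 0 <= x * (1 - x) by rewrite mulr_ge0//; lra.
(* This is [(a - b) ^+ 2 <= 2 * a ^+ 2 + 2 * b ^+ 2], with [h2] for the logarithms and [h3] for the
   means. *)
have h4 : x * (1 - x) * ((f0 - f1) - (m0 - m1)) ^+ 2 <= 16 + 2 * B * (t * D').
  have : 0 <= x * (1 - x) * ((f0 - f1) + (m0 - m1)) ^+ 2 by rewrite mulr_ge0// sqr_ge0.
  by rewrite !expr2 in h2 h3 *; nra.
have h5 : 2 * B * D <= 2 * B * (4 + (1 - t) * D') by rewrite ler_wpM2l// mulr_ge0.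
have h6 : x * V0 + (1 - x) * V1 + 2 * B * D' <= n%:R * (16 + 8 * B) by nra.
rewrite -natr1; lra.
Qed.

(** Take [B = 13 * sqrt n] from [mean_gap]; then [16 + 8 * B] is at most [(16 + 104) * sqrt n]. *)
Lemma info_var_le n : (0 < n)%N -> info_var 0 false n <= 120 * (n%:R * Num.sqrt n%:R).
Proof.
move=> n0; have B0 : 0 <= 13 * Num.sqrt (n%:R : R) by rewrite mulr_ge0// sqrtr_ge0.
have := info_var_bound B0 (fun m k => @mean_gap n m k n0) 0 false (leqnn n).
set D := `|_ - _|; have D0 : 0 <= D by exact: normr_ge0.
have s1 : 1 <= Num.sqrt n%:R :> R by rewrite -[leLHS]sqrtr1 ler_sqrt ?ler0n// ler1n.
have n0' : 0 <= n%:R :> R by exact: ler0n.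
by nra.
Qed.

Lemma chebyshev_info n (e : R) : (0 < n)%N -> 0 < e ->
  \sum_(w <- words n | n%:R * e <= `|info p q 0 false w - mean p q 0 1 n|)
     chain_mass p q 0 false w <= 120 / e ^+ 2 / Num.sqrt n%:R.
Proof.
move=> n0 e0; have n0' : 0 < n%:R :> R by rewrite ltr0n.
have ne : 0 < (n%:R * e) ^+ 2 by rewrite exprn_gt0// mulr_gt0.
rewrite -(ler_pM2r ne).
have -> : 120 / e ^+ 2 / Num.sqrt n%:R * (n%:R * e) ^+ 2 = 120 * (n%:R * Num.sqrt n%:R).
  have s0 : 0 < Num.sqrt n%:R :> R by rewrite sqrtr_gt0.
  have -> : n%:R = Num.sqrt n%:R ^+ 2 :> R by rewrite sqr_sqrtr// ltW.
  have -> : Num.sqrt (Num.sqrt n%:R ^+ 2) = Num.sqrt n%:R :> R by rewrite sqrtr_sqr ger0_norm// ltW.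
  by field; rewrite (gt_eqF s0) (gt_eqF e0).
apply: le_trans (info_var_le n0).
rewrite mulr_suml big_mkcond /info_var; apply: ler_sum => w _.
have /andP[m0 _] := chain_mass01 p01 q01 0 false w.
case: ifPn => [h|_]; last by rewrite mulr_ge0// sqr_ge0.
rewrite ler_wpM2l// -[leRHS]real_normK ?num_real// ler_sqr// nnegrE//.
by rewrite mulr_ge0// ltW.
Qed.

End Variance.

(** * Law of large numbers *)

Lemma cylP w (x : K) : cyl w x <-> mkseq x (size w) = w.
Proof.
split=> [h|h i iw]; last by rewrite -[w in RHS]h nth_mkseq.
apply: (@eq_from_nth _ false); first by rewrite size_mkseq.
by move=> i; rewrite size_mkseq => iw; rewrite nth_mkseq// h.
Qed.

Lemma cyl_mkseqP (x y : K) n : cyl (mkseq x n) y <-> (forall i, (i < n)%N -> x i = y i).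
Proof.
split=> h i; last by rewrite size_mkseq => ni; rewrite nth_mkseq// h.
by move=> ni; rewrite h ?size_mkseq// nth_mkseq.
Qed.

Lemma measurable_cyl w : measurable (cyl w : set KM).
Proof. by apply: sub_sigma_algebra; exists w. Qed.

Lemma nneseries_le_bound (R : realType) (u : nat -> \bar R) (c : \bar R) :
  (forall n, 0 <= u n)%E -> (forall n, \sum_(0 <= i < n) u i <= c)%E ->
  (\sum_(i <oo) u i <= c)%E.
Proof.
move=> u0 uc; apply: lime_le; first exact: is_cvg_nneseries.
by apply: nearW => n; exact: uc.
Qed.

Definition cyls (l : seq (seq bool)) : set KM := \big[setU/set0]_(w <- l) cyl w.

Lemma cylsP n (P : pred (seq bool)) x :
  cyls [seq w <- words n | P w] x <-> P (mkseq x n).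
Proof.
rewrite /cyls -bigcup_seq; split=> [[w /=]|h].
  by rewrite mem_filter mem_words => /andP[Pw /eqP sw] /cylP; rewrite sw => ->.
exists (mkseq x n) => /=; last by apply/cylP; rewrite size_mkseq.
by rewrite mem_filter h mem_words size_mkseq eqxx.
Qed.

Lemma measurable_cyls l : measurable (cyls l).
Proof. by apply: bigsetU_measurable => w _; exact: measurable_cyl. Qed.

Lemma fourth_power_bracket n : exists m, (m ^ 4 <= n < m.+1 ^ 4)%N.
Proof.
elim: n => [|n [m /andP[h1 h2]]]; first by exists 0%N.
have [h|h] := ltnP n.+1 (m.+1 ^ 4); first by exists m; rewrite h andbT ltnW.
by exists m.+1; rewrite h; apply: (leq_ltn_trans h2); rewrite ltn_exp2r.
Qed.

(** Consecutive fourth powers have ratio tending to 1, so any gap between two rates absorbs the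
    passage from one to the next. The 15 is [4 + 6 + 4 + 1], from the binomial expansion. *)
Lemma fourth_power_ratio (R : realType) (a b : R) : 0 <= a < b ->
  exists M, forall m, (M <= m)%N -> (m.+1 ^ 4)%:R * a <= (m ^ 4)%:R * b.
Proof.
move=> /andP[a0 ab]; have ba : 0 < b - a by lra.
exists (Num.bound (15 * a / (b - a))).+1 => m Mm.
have h : 15 * a / (b - a) <= m%:R.
  apply: (le_trans (ltW (archi_boundP _))); first by rewrite divr_ge0 ?mulr_ge0// ltW.
  by rewrite ler_nat ltnW.
have m1 : 1 <= m%:R :> R by rewrite ler1n (leq_trans _ Mm).
move: h; rewrite ler_pdivrMr// => h.
rewrite !natrX -natr1; set x := m%:R in h m1 *.
have h1 : (x + 1) ^+ 4 <= x ^+ 4 + 15 * x ^+ 3.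
  have -> : (x + 1) ^+ 4 = x ^+ 4 + (4 * x ^+ 3 + 6 * x ^+ 2 + 4 * x + 1) by ring.
  have x2 : x <= x ^+ 2 by nra.
  have x3 : x ^+ 2 <= x ^+ 3 by rewrite exprS [leLHS]expr2 -expr2; nra.
  by lra.
apply: (@le_trans _ _ ((x ^+ 4 + 15 * x ^+ 3) * a)); first by rewrite ler_wpM2r.
have x30 : 0 <= x ^+ 3 by rewrite exprn_ge0//; lra.
have : x ^+ 3 * (15 * a) <= x ^+ 3 * (x * (b - a)) by rewrite ler_wpM2l.
by rewrite [x ^+ 4]exprSr; lra.
Qed.

Lemma pow2E (R : realType) (x : R) : 2 `^ x = expR (x * ln 2).
Proof. by rewrite /powR pnatr_eq0. Qed.

Section LargeNumbers.
Context {R : realType}.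
Variables (p q : nat -> R) (mu : {measure set KM -> \bar R}).
Hypothesis p01 : forall n, 0 <= p n <= 1.
Hypothesis q01 : forall n, 0 <= q n <= 1.
Hypothesis muE : is_markov_measure p q mu.

Local Notation mass := (markov_mass p q).
Local Notation H := (mean p q 0 1).

Lemma mu_setT : mu setT = 1%E.
Proof.
have -> : setT = cyl [::] :> set KM by apply/seteqP; split.
by rewrite muE markov_massE.
Qed.

Lemma mu_fin_num (A : set KM) : measurable A -> mu A \is a fin_num.
Proof. by move=> mA; apply: lty_fin_num_fun => //; rewrite mu_setT ltry. Qed.

Lemma mass_mkseq_mono (x : K) m n : (m <= n)%N -> mass (mkseq x n) <= mass (mkseq x m).
Proof.
move=> mn; rewrite !markov_massE.
have -> : mkseq x m = take m (mkseq x n) by rewrite -map_take take_iota (minn_idPl mn).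
exact: chain_mass_take.
Qed.

Lemma mu_cyls_le l : (mu (cyls l) <= (\sum_(w <- l) mass w)%:E)%E.
Proof.
rewrite /cyls; elim: l => [|w l IH]; first by rewrite !big_nil measure0.
rewrite !big_cons EFinD; apply: le_trans (measureU2 mu _ _) _.
- exact: measurable_cyl.
- exact: measurable_cyls.
- have h : (mu (cyl w) <= (mass w)%:E)%E by rewrite muE.
  exact: leeD h IH.
Qed.

(** Words of mass 0 are thrown in because [info] says nothing about their mass; they cost no
    measure. *)
Definition atypical n (e : R) : set KM := cyls [seq w <- words n |
  (n%:R * e <= `|info p q 0 false w - H n|) || (chain_mass p q 0 false w == 0)].

Lemma mu_atypical n e : (0 < n)%N -> 0 < e ->
  (mu (atypical n e) <= (120 / e ^+ 2 / Num.sqrt n%:R)%:E)%E.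
Proof.
move=> n0 e0; apply: (le_trans (mu_cyls_le _)); rewrite lee_fin.
apply: le_trans (chebyshev_info p01 q01 n0 e0).
rewrite big_filter big_mkcond [leRHS]big_mkcond; apply: ler_sum => w _.
rewrite markov_massE; have /andP[m0 _] := chain_mass01 p01 q01 0 false w.
by case: ifP => //=; case: ifP => //= _; case: eqP => // ->.
Qed.

Lemma typical_mass n e x : ~ atypical n e x ->
  expR (- (H n + n%:R * e)) <= mass (mkseq x n) <= expR (- (H n - n%:R * e)).
Proof.
move=> /cylsP /negP; rewrite negb_or -ltNge => /andP[h1 h2].
have /andP[m0 _] := chain_mass01 p01 q01 0 false (mkseq x n).
have {m0 h2} m0 : 0 < chain_mass p q 0 false (mkseq x n) by rewrite lt_neqAle eq_sym h2.
move: h1; rewrite infoE// ltr_norml markov_massE => /andP[h1 h2].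
by rewrite -[X in _ <= X <= _](lnK m0) !ler_expR; apply/andP; split; lra.
Qed.

(** The exceptional set depends on [n], but every large [n] is allowed, not only fourth powers. This
    serves where the entropy is controlled only along a subsequence. *)
Lemma typical_in_probability (e eta : R) : 0 < e -> 0 < eta ->
  exists N, forall n, (N <= n)%N -> (mu (atypical n e) < eta%:E)%E.
Proof.
move=> e0 eta0; set c := 120 / e ^+ 2 / eta.
have c0 : 0 <= c by rewrite !divr_ge0 ?sqr_ge0// ltW.
exists (Num.bound (c ^+ 2)).+1 => n hn.
have n0 : (0 < n)%N by exact: leq_trans hn.
have n0' : 0 < n%:R :> R by rewrite ltr0n.
apply: (le_lt_trans (mu_atypical n0 e0)); rewrite lte_fin.
have hc : c < Num.sqrt n%:R.
  rewrite -[c]ger0_norm// -sqrtr_sqr ltr_sqrt//.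
  by apply: (lt_trans (archi_boundP (sqr_ge0 _))); rewrite ltr_nat.
by rewrite ltr_pdivrMr ?sqrtr_gt0// [ltRHS]mulrC -ltr_pdivrMr.
Qed.

(** A Borel-Cantelli argument: the Chebyshev bound [c / sqrt n] is not summable over all [n], but at
    [n = m ^ 4] it is [c / m ^ 2], and the union of the late exceptional sets is small. *)
Lemma typical_eventually (e eta : R) : 0 < e -> 0 < eta ->
  exists M (B : set KM), [/\ measurable B, (mu B < eta%:E)%E &
    forall x, ~ B x -> forall m, (M <= m)%N -> ~ atypical (m ^ 4) e x].
Proof.
move=> e0 eta0; set c := 120 / e ^+ 2.
have c0 : 0 < c by rewrite divr_gt0// exprn_gt0.
set M := (Num.bound (c / eta)).+1.
have M0 : 0 < M%:R :> R by rewrite ltr0n.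
pose A i := atypical ((i + M).+1 ^ 4) e.
have mA i : measurable (A i) by exact: measurable_cyls.
exists M.+1, (\bigcup_i A i); split.
- exact: bigcup_measurable.
- apply: (@le_lt_trans _ _ (c / M%:R)%:E); last first.
    rewrite lte_fin ltr_pdivrMr// mulrC -ltr_pdivrMr//.
    apply: (lt_trans (archi_boundP _)); first by rewrite divr_ge0// ltW.
    by rewrite ltr_nat.
  apply: le_trans (measure_sigma_subadditive mu mA _ (@subset_refl _ _)) _.
    exact: bigcup_measurable.
  apply: nneseries_le_bound => // n.
  (* With [y = i + M], [c / (y + 1) ^ 2] is at most [c / y - c / (y + 1)], and the sum telescopes to
     at most [c / M]. *)
  apply: (@le_trans _ _ (\sum_(0 <= i < n) (c / (i + M)%:R - c / (i.+1 + M)%:R)%:E)%E).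
    apply: lee_sum => i _; apply: (le_trans (mu_atypical _ e0)); first by rewrite expn_gt0.
    rewrite lee_fin -/c addSn.
    have y0 : 0 < (i + M)%:R :> R by rewrite ltr0n addn_gt0 orbT.
    have -> : Num.sqrt ((i + M).+1 ^ 4)%:R = (i + M).+1%:R ^+ 2 :> R.
      by rewrite natrX (_ : 4 = 2 * 2)%N// exprM sqrtr_sqr ger0_norm// sqr_ge0.
    rewrite -natr1; set y := (i + M)%:R in y0 *.
    have -> : c / y - c / (y + 1) = c / (y * (y + 1)).
      by field; rewrite !gt_eqF//; lra.
    have y1 : 0 < y + 1 by lra.
    rewrite ler_pM2l// lef_pV2 ?posrE ?mulr_gt0 ?exprn_gt0//; lra.
  rewrite sumEFin lee_fin -[leLHS]opprK -sumrN.
  under eq_bigr do rewrite opprB.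
  by rewrite telescope_sumr// opprB add0n lerBlDr lerDl divr_ge0// ltW.
- move=> x Bx [//|m] Mm am; apply: Bx; exists (m - M)%N => //.
  by rewrite /A subnK.
Qed.

(** For [m ^ 4 <= n < m.+1 ^ 4] the mass at [n] is at most the mass at [m ^ 4], and
    [fourth_power_ratio] absorbs the change of exponent. *)
Lemma mass_le_eventually (s s1 eta : R) N0 : 0 <= s < s1 -> 0 < eta ->
  (forall n, (N0 <= n)%N -> n%:R * (s1 * ln 2) <= H n) ->
  exists N (B : set KM), [/\ measurable B, (mu B < eta%:E)%E &
    forall x, ~ B x -> forall n, (N <= n)%N -> mass (mkseq x n) <= 2 `^ (- (n%:R * s))].
Proof.
move=> /andP[s0 ss1] eta0 HN.
have l2 : 0 < ln 2 :> R by rewrite ln_gt0// ltr1n.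
(* Half of the gap pays for the deviation at [m ^ 4], the other half for passing from [m ^ 4] to
   [n]. *)
set e := (s1 - s) / 2 * ln 2.
have e0 : 0 < e by rewrite mulr_gt0// divr_gt0//; lra.
have [M [B [mB muB hB]]] := typical_eventually e0 eta0.
have [|M' hM'] := @fourth_power_ratio _ s ((s1 + s) / 2); first by lra.
pose L := maxn (maxn M M') N0.
exists (L.+1 ^ 4)%N, B; split=> // x Bx n Nn.
have [m /andP[mn nm]] := fourth_power_bracket n.
have Lm : (L <= m)%N.
  by rewrite -ltnS -(@ltn_exp2r _ _ 4)// (leq_ltn_trans _ nm)// (leq_trans _ Nn)// leq_exp2r.
have [Mm M'm N0m] : [/\ (M <= m)%N, (M' <= m)%N & (N0 <= m)%N].
  by move: Lm; rewrite !geq_max -!andbA => /and3P[].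
apply: (le_trans (mass_mkseq_mono x mn)).
have /typical_mass/andP[_] := hB x Bx m Mm; move/le_trans; apply.
rewrite !pow2E ler_expR mulNr lerN2.
have H4 : (m ^ 4)%:R * (s1 * ln 2) <= H (m ^ 4).
  by apply: HN; apply: (leq_trans N0m); case: (m) => // k; rewrite -[leqLHS]expn1 leq_pexp2l.
have h5 := hM' m M'm.
have h6 : n%:R * s <= (m ^ 4)%:R * ((s1 + s) / 2).
  by apply: le_trans h5; rewrite ler_wpM2r// ler_nat ltnW.
have : n%:R * s * ln 2 <= (m ^ 4)%:R * ((s1 + s) / 2) * ln 2 by rewrite ler_pM2r.
by rewrite /e; lra.
Qed.

(** Mirror image: the mass at [n] is bounded below by the mass at the next fourth power. *)
Lemma mass_ge_eventually (s s1 eta : R) N0 : 0 <= s1 < s -> 0 < eta ->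
  (forall n, (N0 <= n)%N -> H n <= n%:R * (s1 * ln 2)) ->
  exists N (B : set KM), [/\ measurable B, (mu B < eta%:E)%E &
    forall x, ~ B x -> forall n, (N <= n)%N -> 2 `^ (- (n%:R * s)) <= mass (mkseq x n)].
Proof.
move=> /andP[s0 ss1] eta0 HN.
have l2 : 0 < ln 2 :> R by rewrite ln_gt0// ltr1n.
set e := (s - s1) / 2 * ln 2.
have e0 : 0 < e by rewrite mulr_gt0// divr_gt0//; lra.
have [M [B [mB muB hB]]] := typical_eventually e0 eta0.
have [|M' hM'] := @fourth_power_ratio _ ((s1 + s) / 2) s; first by lra.
pose L := maxn (maxn M M') N0.
exists (L.+1 ^ 4)%N, B; split=> // x Bx n Nn.
have [m /andP[mn nm]] := fourth_power_bracket n.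
have Lm : (L <= m)%N.
  by rewrite -ltnS -(@ltn_exp2r _ _ 4)// (leq_ltn_trans _ nm)// (leq_trans _ Nn)// leq_exp2r.
have [Mm M'm N0m] : [/\ (M <= m)%N, (M' <= m)%N & (N0 <= m)%N].
  by move: Lm; rewrite !geq_max -!andbA => /and3P[].
apply: le_trans (mass_mkseq_mono x (ltnW nm)).
have /typical_mass/andP[+ _] := hB x Bx m.+1 (leqW Mm); apply: le_trans.
rewrite !pow2E ler_expR mulNr lerN2.
have H4 : H (m.+1 ^ 4) <= (m.+1 ^ 4)%:R * (s1 * ln 2).
  by apply: HN; apply: (leq_trans (leqW N0m)); rewrite -[leqLHS]expn1 leq_pexp2l.
have h5 := hM' m M'm.
have h6 : (m.+1 ^ 4)%:R * ((s1 + s) / 2) <= n%:R * s.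
  by apply: (le_trans h5); rewrite ler_wpM2r ?ler_nat//; lra.
have : (m.+1 ^ 4)%:R * ((s1 + s) / 2) * ln 2 <= n%:R * s * ln 2 by rewrite ler_pM2r.
by rewrite /e; lra.
Qed.

Lemma mass_le_in_probability (s s1 eta : R) : s < s1 -> 0 < eta ->
  exists N, forall n, (N <= n)%N -> n%:R * (s1 * ln 2) <= H n ->
  exists B : set KM, [/\ measurable B, (mu B < eta%:E)%E &
    forall x, ~ B x -> mass (mkseq x n) <= 2 `^ (- (n%:R * s))].
Proof.
move=> ss1 eta0.
have l2 : 0 < ln 2 :> R by rewrite ln_gt0// ltr1n.
set e := (s1 - s) * ln 2; have e0 : 0 < e by rewrite mulr_gt0//; lra.
have [N hN] := typical_in_probability e0 eta0.
exists N => n Nn Hn; exists (atypical n e); split; [exact: measurable_cyls|exact: hN|].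
move=> x /typical_mass/andP[_ /le_trans]; apply.
by rewrite !pow2E ler_expR mulNr lerN2 /e; lra.
Qed.

Lemma mass_ge_in_probability (s s1 eta : R) : s1 < s -> 0 < eta ->
  exists N, forall n, (N <= n)%N -> H n <= n%:R * (s1 * ln 2) ->
  exists B : set KM, [/\ measurable B, (mu B < eta%:E)%E &
    forall x, ~ B x -> 2 `^ (- (n%:R * s)) <= mass (mkseq x n)].
Proof.
move=> ss1 eta0.
have l2 : 0 < ln 2 :> R by rewrite ln_gt0// ltr1n.
set e := (s - s1) * ln 2; have e0 : 0 < e by rewrite mulr_gt0//; lra.
have [N hN] := typical_in_probability e0 eta0.
exists N => n Nn Hn; exists (atypical n e); split; [exact: measurable_cyls|exact: hN|].
move=> x /typical_mass/andP[+ _]; apply: le_trans.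
by rewrite !pow2E ler_expR mulNr lerN2 /e; lra.
Qed.

End LargeNumbers.

(** * Geometry of the Cantor space *)

Section Geometry.
Context {R : realType}.
Local Notation dist := (@dist R).
Local Notation diam := (@diam R).
Implicit Types (x y : K) (r s : R).

Lemma exprVn2_powR n : 2%:R ^- n = 2 `^ (- n%:R) :> R.
Proof. by rewrite powRN powR_mulrn. Qed.

Lemma powR_exprVn2 n s : (2%:R ^- n) `^ s = 2 `^ (- (n%:R * s)) :> R.
Proof. by rewrite exprVn2_powR -powRrM mulNr. Qed.

Lemma ler_exprVn2 m n : (2%:R ^- m <= 2%:R ^- n :> R) = (n <= m)%N.
Proof. by rewrite lef_pV2 ?posrE ?exprn_gt0// ler_eXn2l// ltr1n. Qed.

Lemma pow2_small (s e : R) : 0 < s -> 0 < e ->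
  exists N, forall n, (N <= n)%N -> 2 `^ (- (n%:R * s)) <= e.
Proof.
move=> s0 e0; have l2 : 0 < ln 2 :> R by rewrite ln_gt0// ltr1n.
have sl : 0 < s * ln 2 by exact: mulr_gt0.
exists (Num.bound (`|ln e| / (s * ln 2))) => n hn.
rewrite pow2E -[leRHS](lnK e0) ler_expR mulNr lerNl -mulrA.
apply: (le_trans (ler_norm _)); rewrite normrN -ler_pdivrMr//.
apply: (le_trans (ltW (archi_boundP _))); last by rewrite ler_nat.
by rewrite divr_ge0// ltW.
Qed.

Lemma dist_spec x y : (x = y /\ dist x y = 0) \/
  exists n, [/\ x n != y n, forall i, (i < n)%N -> x i = y i & dist x y = 2%:R ^- n].
Proof.
rewrite /Defs.dist; case: pselect => [h|h]; last first.
  left; split=> //; apply/funext => n; apply/eqP/negPn/negP => xy.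
  by apply: h; exists n.
right; case: ex_minnP => n xy hn; exists n; split=> // i ni.
by apply/eqP/negPn/negP => /hn; rewrite leqNgt ni.
Qed.

Lemma dist_le1 x y : dist x y <= 1.
Proof.
have [[_ ->]//|[n [_ _ ->]]] := dist_spec x y.
by rewrite -[leRHS]invr1 -(expr0 2%:R) ler_exprVn2.
Qed.

Lemma dist_leP x y n : dist x y <= 2%:R ^- n <-> (forall i, (i < n)%N -> x i = y i).
Proof.
have [[-> ->]|[k [xy hk ->]]] := dist_spec x y; first by rewrite invr_ge0 exprn_ge0.
rewrite ler_exprVn2; split=> [nk i ni|h]; first by apply: hk; exact: leq_trans nk.
by rewrite leqNgt; apply/negP => /h xyk; rewrite xyk eqxx in xy.
Qed.

(** Nonzero distances are powers of 1/2, so one below [2 * 2 ^- n] is at most [2 ^- n]. *)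
Lemma cball_cyl x r n : 2%:R ^- n <= r < 2 * 2%:R ^- n ->
  cball x r = cyl (mkseq x n).
Proof.
move=> /andP[nr rn]; apply/seteqP; split=> y; rewrite /cball /=.
  move=> xyr; apply/cyl_mkseqP.
  have [[-> _]//|[k [xy hk dk]]] := dist_spec x y.
  apply/dist_leP; rewrite dk ler_exprVn2 leqNgt; apply/negP => kn.
  have : 2%:R ^- k < 2 * 2%:R ^- n :> R by rewrite -dk; exact: le_lt_trans rn.
  apply/negP; rewrite -leNgt; apply: (@le_trans _ _ (2 * 2%:R ^- k.+1)).
    by rewrite ler_pM2l// ler_exprVn2.
  by rewrite exprS invfM mulrA divff// mul1r.
by move/cyl_mkseqP/dist_leP/le_trans; apply.
Qed.

Lemma dyadic_scale r : 0 < r < 2 -> exists n, 2%:R ^- n <= r < 2 * 2%:R ^- n.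
Proof.
move=> /andP[r0 r2].
have ex : exists n, 2%:R ^- n <= r.
  have [N /(_ N (leqnn _))] := pow2_small (@ltr01 R) r0.
  by rewrite mulr1 -exprVn2_powR => h; exists N.
case: (ex_minnP ex) => -[|n] hn hmin; first by exists 0%N; rewrite hn expr0 invr1 mulr1.
exists n.+1; rewrite hn /= ltNge exprS invfM mulrA divff// mul1r.
by apply/negP => /hmin; rewrite ltnn.
Qed.

(** The supremum lies in [0, 1], so [fine] in [diam] loses nothing. *)
Lemma diam_sup (E : set K) :
  (diam E)%:E = ereal_sup ([set (dist xy.1 xy.2)%:E | xy in E `*` E] `|` [set 0%:E]).
Proof.
rewrite fineK// fin_numElt; apply/andP; split.
  by apply: (@lt_le_trans _ _ 0%E); [exact: ltNyr|apply: ereal_sup_ubound; right].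
apply: (@le_lt_trans _ _ 1%E); last exact: ltry.
by apply: ge_ereal_sup => _ [[xy _ <-]|->]; rewrite lee_fin ?dist_le1.
Qed.

Lemma diam_ge0 (E : set K) : 0 <= diam E.
Proof. by rewrite -lee_fin diam_sup; apply: ereal_sup_ubound; right. Qed.

Lemma dist_le_diam (E : set K) x y : E x -> E y -> dist x y <= diam E.
Proof.
move=> Ex Ey; rewrite -lee_fin diam_sup.
by apply: ereal_sup_ubound; left; exists (x, y).
Qed.

Lemma diam_le (E : set K) r : 0 <= r -> (forall x y, E x -> E y -> dist x y <= r) ->
  diam E <= r.
Proof.
move=> r0 h; rewrite -lee_fin diam_sup; apply: ge_ereal_sup => _ [[xy [] Ex Ey <-]|->];
by rewrite lee_fin// h.
Qed.

Lemma diam_cyl w : diam (cyl w) <= 2%:R ^- size w.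
Proof.
apply: diam_le; first by rewrite invr_ge0 exprn_ge0.
by move=> x y wx wy; apply/dist_leP => i iw; rewrite wx// wy.
Qed.

Lemma diam_set0 : diam set0 = 0.
Proof. by apply/eqP; rewrite eq_le diam_ge0 andbT; apply: diam_le. Qed.

Lemma sum_truncated (c : R) k m :
  \sum_(0 <= i < m) (if (i < k)%N then c else 0) = (minn m k)%:R * c.
Proof.
elim: m => [|m IH]; first by rewrite big_geq// min0n mul0r.
rewrite big_nat_recr//= IH; case: ltnP => h.
  by rewrite (minn_idPl h) -natr1 mulrDl mul1r.
by rewrite addr0 (minn_idPr (leqW h)).
Qed.

Lemma hausdorff_ge0 s (E : set K) : (0 <= hausdorff s E)%E.
Proof.
apply: ereal_sup_ge; exists (hausdorff_delta s 1 E); first by exists 1 => /=.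
apply: le_ereal_inf_tmp => _ [U _ <-]; apply: nneseries_ge0 => i _ _.
by rewrite lee_fin powR_ge0.
Qed.

Lemma dimH_le s (E : set K) : 0 < s -> hausdorff s E = 0%E -> (dimH R E <= s%:E)%E.
Proof. by move=> s0 hs; apply: ereal_inf_lbound; exists s. Qed.

Lemma dimP_le s (E : set K) : 0 < s -> packing s E = 0%E -> (dimP R E <= s%:E)%E.
Proof. by move=> s0 hs; apply: ereal_inf_lbound; exists s. Qed.

Lemma packing_delta_ge0 s delta (E : set K) : (0 <= packing_delta s delta E)%E.
Proof. by apply: ereal_sup_ubound; right. Qed.

Lemma packing_pre_ge0 s (E : set K) : (0 <= packing_pre s E)%E.
Proof. by apply: le_ereal_inf_tmp => _ [d _ <-]; exact: packing_delta_ge0. Qed.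

Lemma packing_ge0 s (E : set K) : (0 <= packing s E)%E.
Proof.
by apply: le_ereal_inf_tmp => _ [F _ <-]; apply: nneseries_ge0 => i _ _; exact: packing_pre_ge0.
Qed.

Lemma packing_eq0_pre s (E : set K) : packing_pre s E = 0%E -> packing s E = 0%E.
Proof.
move=> h; apply/eqP; rewrite eq_le packing_ge0 andbT; apply: ge_ereal_inf.
exists (\sum_(i <oo) packing_pre s ((fun=> E) i))%E; last by rewrite eseries0.
by exists (fun=> E) => // x Ex; exists 0%N.
Qed.

End Geometry.

(** * Covering and packing estimates *)

Lemma size_mul_le_sum (R : realType) (T : eqType) (l : seq T) (c : R) (F : T -> R) :
  {in l, forall w, c <= F w} -> (size l)%:R * c <= \sum_(w <- l) F w.
Proof.
move=> h; rewrite -sum1_size natr_sum mulr_suml big_seq [leRHS]big_seq.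
by apply: ler_sum => w wl; rewrite mul1r h.
Qed.

Section Dimensions.
Context {R : realType}.
Variables (p q : nat -> R) (mu : {measure set KM -> \bar R}).
Hypothesis p01 : forall n, 0 <= p n <= 1.
Hypothesis q01 : forall n, 0 <= q n <= 1.
Hypothesis muE : is_markov_measure p q mu.

Local Notation mass := (markov_mass p q).

Lemma mu_le (A B : set KM) : measurable A -> measurable B -> A `<=` B -> (mu A <= mu B)%E.
Proof. by move=> mA mB AB; apply: le_measure; rewrite ?inE. Qed.

Lemma mu_cball_le (s : R) N (x : K) (r : R) : 0 < s -> 0 <= r < 2%:R ^- N ->
  (forall n, (N <= n)%N -> mass (mkseq x n) <= 2 `^ (- (n%:R * s))) ->
  measurable (cball x r : set KM) /\ (mu (cball x r) <= (r `^ s)%:E)%E.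
Proof.
move=> s0 /andP[r0 rN] hx.
have N1 : 2%:R ^- N <= 1 :> R by rewrite -[leRHS]invr1 -(expr0 2%:R) ler_exprVn2.
move: r0; rewrite le_eqVlt => /predU1P[<-|r0].
  have E0 : cball x (0 : R) = \bigcap_n cyl (mkseq x n) :> set KM.
    apply/seteqP; split=> y; rewrite /cball /=.
      move=> d0 n _; apply/cyl_mkseqP/(@dist_leP R).
      by apply: (le_trans d0); rewrite invr_ge0 exprn_ge0.
    move=> h; have [[_ ->]//|[n [xy _ _]]] := @dist_spec R x y.
    by have /cyl_mkseqP/(_ n (ltnSn _)) xyn := h n.+1 I; rewrite xyn eqxx in xy.
  have m0 : measurable (cball x (0 : R) : set KM).
    by rewrite E0; apply: bigcap_measurable => // k _; exact: measurable_cyl.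
  split=> //; rewrite powR0 ?gt_eqF//; apply/lee_addgt0Pr => e e0; rewrite add0e.
  have [n hn] := pow2_small s0 e0; pose k := maxn n N.
  apply: (@le_trans _ _ (mu (cyl (mkseq x k)))).
    by apply: mu_le => //; [exact: measurable_cyl|rewrite E0; exact: bigcap_inf].
  rewrite muE lee_fin; apply: (le_trans (hx k _)); first exact: leq_maxr.
  by apply: hn; exact: leq_maxl.
have [|n nr] := @dyadic_scale R r; first by rewrite r0 /=; lra.
rewrite (cball_cyl x nr); split; first exact: measurable_cyl.
have /andP[nr' _] := nr.
have Nn : (N <= n)%N.
  by apply: ltnW; rewrite ltnNge -(ler_exprVn2 (R := R)) -ltNge; exact: le_lt_trans rN.
rewrite muE lee_fin; apply: (le_trans (hx _ Nn)); rewrite -powR_exprVn2.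
by apply: ge0_ler_powR; rewrite ?nnegrE ?invr_ge0 ?exprn_ge0// ltW.
Qed.

(** The mass distribution principle: in a cover of [E] by small sets, each piece meeting [A] carries
    at most its diameter to the power [s]. *)
Lemma mass_distribution (s : R) N (A E : set KM) : 0 < s -> measurable A -> A `<=` E ->
  (forall x, A x -> forall n, (N <= n)%N -> mass (mkseq x n) <= 2 `^ (- (n%:R * s))) ->
  (mu A <= hausdorff s E)%E.
Proof.
move=> s0 mA AE hA; set d : R := 2%:R ^- N.+1.
have d0 : 0 < d by rewrite invr_gt0 exprn_gt0.
have dN : d < 2%:R ^- N by rewrite ltNge ler_exprVn2 ltnn.
apply: (@le_trans _ _ (hausdorff_delta s d E)); last first.
  by apply: ereal_sup_ubound; exists d.
apply: le_ereal_inf_tmp => _ [U [EU Ud] <-].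
(* The sets [U i] need not be measurable: each is replaced by the ball of radius [diam (U i)] around
   one of its points in [A], or by the empty set. *)
have /choice[V hV] i : exists V : set KM, [/\ measurable V, U i `&` A `<=` V &
    (mu V <= ((diam R (U i)) `^ s)%:E)%E].
  have [[x [Ux Ax]]|nx] := pselect (exists x, U i x /\ A x); last first.
    exists set0; rewrite measure0 lee_fin powR_ge0; split=> // x Ux; apply: nx; by exists x.
  have [|mB muB] := @mu_cball_le s N x (diam R (U i)) s0 _ (hA x Ax).
    by rewrite diam_ge0 (le_lt_trans (Ud i)).
  exists (cball x (diam R (U i))); split=> // y [Uy _]; exact: dist_le_diam.
apply: (@le_trans _ _ (\sum_(i <oo) mu (V i))%E).
  apply: measure_sigma_subadditive => //; first by move=> i; case: (hV i).
  move=> x Ax; have [i _ Ux] := EU x (AE x Ax); exists i => //.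
  by case: (hV i) => _ h _; apply: h.
by apply: lee_nneseries => [i _ _|i _]; [exact: measure_ge0|case: (hV i)].
Qed.

Lemma hausdorff_eq0 (s s2 : R) (E : set KM) : 0 < s -> s2 < s ->
  (forall N, exists2 n, (N <= n)%N &
     forall x, E x -> 2 `^ (- (n%:R * s2)) <= mass (mkseq x n)) ->
  hausdorff s E = 0%E.
Proof.
move=> s0 ss hE; apply/eqP; rewrite eq_le hausdorff_ge0 andbT.
apply: ge_ereal_sup => _ [d /= d0 <-]; apply/lee_addgt0Pr => e e0; rewrite add0e.
have [|N1 hN1] := @pow2_small R (s - s2) e _ e0; first by lra.
have [N2 hN2] := @pow2_small R 1 d ltr01 d0.
have [n nN hn] := hE (maxn N1 N2).
have /andP[n1 n2] : (N1 <= n)%N && (N2 <= n)%N by rewrite -geq_max.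
pose l := [seq w <- words n | 2 `^ (- (n%:R * s2)) <= mass w].
have sl i : (i < size l)%N -> size (nth [::] l i) = n.
  move=> /(mem_nth [::]); rewrite mem_filter mem_words => /andP[_ /eqP//].
have hl : (size l)%:R * 2 `^ (- (n%:R * s2)) <= 1.
  have := sum_chain_mass p q 0 false n.
  rewrite (bigID (fun w => 2 `^ (- (n%:R * s2)) <= mass w)) /= => h.
  have h2 : \sum_(w <- words n | 2 `^ (- (n%:R * s2)) <= mass w) chain_mass p q 0 false w <= 1.
    by rewrite -[leRHS]h lerDl sumr_ge0// => w _; have /andP[] := chain_mass01 p01 q01 0 false w.
  apply: le_trans h2; rewrite -big_filter -/l; apply: size_mul_le_sum => w.
  by rewrite mem_filter markov_massE => /andP[].
pose U i : set K := if (i < size l)%N then cyl (nth [::] l i) else set0.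
apply: ge_ereal_inf; exists (\sum_(i <oo) ((diam R (U i)) `^ s)%:E)%E.
  exists U => //; split=> [x Ex|i].
    have : cyls l x by apply/cylsP; exact: hn.
    rewrite /cyls -bigcup_seq => -[w /= wl wx].
    exists (index w l) => //; rewrite /U index_mem wl nth_index//.
  rewrite /U; case: ifP => il; last by rewrite diam_set0 ltW.
  apply: (le_trans (diam_cyl _)); rewrite sl// exprVn2_powR.
  by have := hN2 n n2; rewrite mulr1.
apply: nneseries_le_bound => [i|m]; first by rewrite lee_fin powR_ge0.
apply: (@le_trans _ _ (\sum_(0 <= i < m) (if (i < size l)%N then 2 `^ (- (n%:R * s)) else 0)%:E)%E).
  apply: lee_sum => i _; rewrite lee_fin /U; case: ifP => il; last first.
    by rewrite diam_set0 powR0// gt_eqF.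
  rewrite -powR_exprVn2; apply: ge0_ler_powR; rewrite ?nnegrE ?diam_ge0 ?invr_ge0 ?exprn_ge0//.
    exact: ltW.
  by rewrite -[in leRHS](sl i il) diam_cyl.
rewrite sumEFin lee_fin sum_truncated.
apply: (@le_trans _ _ ((size l)%:R * 2 `^ (- (n%:R * s)))).
  by rewrite ler_wpM2r ?powR_ge0// ler_nat geq_minr.
have -> : 2 `^ (- (n%:R * s)) = 2 `^ (- (n%:R * s2)) * 2 `^ (- (n%:R * (s - s2))) :> R.
  by rewrite -powRD ?pnatr_eq0 ?implybT//; congr powR; ring.
rewrite mulrA -[leRHS]mul1r; apply: ler_pM => //; rewrite ?mulr_ge0 ?powR_ge0//.
exact: hN1.
Qed.

Lemma packing_eq0 (s s2 : R) N (E : set KM) : 0 < s -> s2 < s ->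
  (forall x, E x -> forall n, (N <= n)%N -> 2 `^ (- (n%:R * s2)) <= mass (mkseq x n)) ->
  packing s E = 0%E.
Proof.
move=> s0 ss hE; apply: packing_eq0_pre.
apply/eqP; rewrite eq_le packing_pre_ge0 andbT.
apply/lee_addgt0Pr => e e0; rewrite add0e.
set c : R := 2 `^ (2 * s); have c0 : 0 < c by rewrite powR_gt0.
have [||N1 hN1] := @pow2_small R (s - s2) (e / c); first by lra.
  exact: divr_gt0.
pose k := maxn N N1; pose d : R := 2%:R ^- k.
have d0 : 0 < d by rewrite invr_gt0 exprn_gt0.
have d1 : d <= 1 by rewrite -[leRHS]invr1 -(expr0 2%:R) ler_exprVn2.
apply: (@le_trans _ _ (packing_delta s d E)).
  by apply: ereal_inf_lbound; exists d.
apply: ge_ereal_sup => _ [[[x r] /= [Ex [rd disj]] <-]|->]; last by rewrite lee_fin ltW.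
pose B i : set KM := if 0 < r i then cball (x i) (r i) else set0.
have hB i : measurable (B i) /\ (((2 * r i) `^ s)%:E <= e%:E * mu (B i))%E.
  rewrite /B; case: ifPn => [r0|]; last first.
    rewrite -leNgt => r0; have -> : r i = 0.
      by apply/eqP; rewrite eq_le r0; case/andP: (rd i).
    by rewrite mulr0 powR0 ?gt_eqF// measure0 mule0.
  have /andP[_ rid] := rd i.
  have [|n nr] := @dyadic_scale R (r i); first by rewrite r0 /=; lra.
  rewrite (cball_cyl (x i) nr); split; first exact: measurable_cyl.
  have /andP[nr1 nr2] := nr.
  have kn : (k <= n)%N by rewrite -(ler_exprVn2 (R := R)); exact: le_trans rid.
  have /andP[Nn N1n] : (N <= n)%N && (N1 <= n)%N by rewrite -geq_max.
  rewrite muE -EFinM lee_fin.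
  apply: (@le_trans _ _ ((2 `^ (2 - n%:R)) `^ s)).
    apply: ge0_ler_powR; rewrite ?nnegrE ?powR_ge0 ?mulr_ge0// ?ltW//.
    rewrite powRD ?pnatr_eq0 ?implybT// -exprVn2_powR.
    have -> : 2 `^ 2 = 4 :> R by rewrite powR_mulrn// -natrX.
    by lra.
  have -> : (2 `^ (2 - n%:R)) `^ s = c * 2 `^ (- (n%:R * (s - s2))) * 2 `^ (- (n%:R * s2)) :> R.
    by rewrite /c -!powRD ?pnatr_eq0 ?implybT// -powRrM; congr powR; ring.
  apply: ler_pM; rewrite ?mulr_ge0 ?powR_ge0//; last exact: hE.
  by rewrite mulrC -ler_pdivlMr//; exact: hN1.
apply: (@le_trans _ _ (\sum_(i <oo) (e%:E * mu (B i)))%E).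
  by apply: lee_nneseries => [i _ _|i _]; [rewrite lee_fin powR_ge0|case: (hB i)].
rewrite nneseriesZl; last by move=> i _; exact: measure_ge0.
have mB i : measurable (B i) by case: (hB i).
rewrite -measure_semi_bigcup//; last exact: bigcup_measurable; last first.
  apply/trivIsetP => i j _ _ ij; rewrite /B.
  case: ifPn => ri; last by rewrite set0I.
  case: ifPn => rj; last by rewrite setI0.
  by apply: disj => //; apply/eqP.
have le1 : (mu (\bigcup_i B i) <= 1)%E.
  by rewrite -(mu_setT muE); apply: mu_le => //; exact: bigcup_measurable.
by rewrite -[leRHS]mule1; apply: lee_wpmul2l => //; rewrite lee_fin ltW.
Qed.

(** Pick a point of [F] in each cylinder of generation [n] that meets [F]: the balls of radius
    [2 ^- n] around them are these cylinders, hence a packing. *)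
Lemma finite_packing_count (s d M : R) (F : set KM) n : 0 < s -> 2%:R ^- n <= d ->
  (packing_delta s d F <= M%:E)%E ->
  (size [seq w <- words n | `[< exists2 x, F x & mkseq x n = w >]])%:R
    * 2 `^ (- (n%:R * s)) <= M.
Proof.
move=> s0 nd hM; set l := [seq w <- words n | _].
have M0 : 0 <= M by rewrite -lee_fin; apply: le_trans hM; exact: packing_delta_ge0.
have [[x0 Fx0]|nF] := pselect (exists x, F x); last first.
  suff -> : l = [::] by rewrite mul0r.
  rewrite /l; elim: (words n) => //= w ws ->; case: asboolP => // -[x Fx].
  by case: nF; exists x.
(* Dummy entries of a packing must also be centred in [F]; [x0] serves for them. *)
have /choice[c hc] w : exists x, F x /\ (w \in l -> mkseq x n = w).
  have [|wl] := boolP (w \in l); last by exists x0.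
  by rewrite mem_filter => /andP[/asboolP[x Fx xw] _]; exists x.
pose x i := c (nth [::] l i).
pose r i : R := if (i < size l)%N then 2%:R ^- n else 0.
have pk : is_delta_packing d F x r.
  split; first by move=> i; case: (hc (nth [::] l i)).
  have n0 : 0 < 2%:R ^- n :> R by rewrite invr_gt0 exprn_gt0.
  split=> [i|i j ij].
    by rewrite /r; case: ifP => _; rewrite ?lexx ?(ltW n0)//=; apply: le_trans nd; exact: ltW.
  rewrite /r; case: ifP => [il _|]; last by rewrite ltxx.
  case: ifP => [jl _|]; last by rewrite ltxx.
  pose h : R := 2%:R ^- n; have nn : h <= h < 2 * h by rewrite lexx ltr_pMl ?ltr1n.
  rewrite !(cball_cyl _ nn) -subset0 => y.
  case=> /cyl_mkseqP yi /cyl_mkseqP yj; apply: ij; apply/eqP.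
  rewrite -(nth_uniq [::] il jl) ?filter_uniq ?words_uniq//.
  have [_ <-] := hc (nth [::] l i); last exact: mem_nth.
  have [_ <-] := hc (nth [::] l j); last exact: mem_nth.
  apply/eqP/eq_in_map => k; rewrite mem_iota add0n => /andP[_ kn].
  exact: etrans (yi k kn) (esym (yj k kn)).
rewrite -lee_fin; apply: le_trans hM.
apply: (@le_trans _ _ (\sum_(i <oo) ((2 * r i) `^ s)%:E)%E); last first.
  by apply: ereal_sup_ubound; left; exists (x, r).
apply: (le_trans _ (nneseries_lim_ge (size l) _)); last first.
  by move=> i _ _; rewrite lee_fin powR_ge0.
rewrite sumEFin lee_fin.
apply: (@le_trans _ _ (\sum_(0 <= i < size l) (if (i < size l)%N then 2 `^ (- (n%:R * s)) else 0))).
  by rewrite sum_truncated minnn.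
apply: ler_sum => i _; rewrite /r; case: ifP => _; last by rewrite powR_ge0.
rewrite -powR_exprVn2; have n0 : 0 <= 2%:R ^- n :> R by rewrite invr_ge0 exprn_ge0.
by apply: ge0_ler_powR; rewrite ?nnegrE ?mulr_ge0 ?(ltW s0)// ler_peMl// ler1n.
Qed.

(** A finite premeasure leaves at most [M * 2]^ (n *
    s)[cylinders of generation]n[meeting]F[; those of mass at most]2 [^ (- (n * s'))] have small
    total mass, and the others lie in [B]. As [F] may be non-measurable, a measurable superset is
    produced. *)
Lemma packing_pre_null (s s' : R) (F : set KM) : 0 < s -> s < s' ->
  (forall (eta : R) N, 0 < eta -> exists n (B : set KM), [/\ (N <= n)%N, measurable B,
     (mu B < eta%:E)%E & forall x, ~ B x -> mass (mkseq x n) <= 2 `^ (- (n%:R * s'))]) ->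
  (packing_pre s F < +oo)%E ->
  forall e : R, 0 < e -> exists C : set KM, [/\ measurable C, F `<=` C & (mu C <= e%:E)%E].
Proof.
move=> s0 ss hmu /ereal_inf_lt[_ [d /= d0 <-] dfin] e e0.
pose M := fine (packing_delta s d F).
have ME : packing_delta s d F = M%:E.
  rewrite fineK// fin_numElt dfin andbT.
  by apply: lt_le_trans (packing_delta_ge0 _ _ _); exact: ltNyr.
have M0 : 0 <= M by rewrite -lee_fin -ME packing_delta_ge0.
(* [M + 1] is used because [M] may be 0. *)
have [||N1 hN1] := @pow2_small R (s' - s) (e / 2 / (M + 1)); first by lra.
  by rewrite !divr_gt0//; lra.
have [N2 hN2] := @pow2_small R 1 d ltr01 d0.
have [|n [B [nN mB muB hB]]] := hmu (e / 2) (maxn N1 N2); first exact: divr_gt0.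
have /andP[n1 n2] : (N1 <= n)%N && (N2 <= n)%N by rewrite -geq_max.
have nd : 2%:R ^- n <= d by rewrite exprVn2_powR; have := hN2 n n2; rewrite mulr1.
have := @finite_packing_count s d M F n s0 nd; rewrite ME lexx => /(_ isT).
set l := [seq w <- words n | _] => hl.
pose l' := [seq w <- l | mass w <= 2 `^ (- (n%:R * s'))].
exists (B `|` cyls l'); split.
- by apply: measurableU => //; exact: measurable_cyls.
- move=> x Fx; have [Bx|nBx] := pselect (B x); [by left|right].
  rewrite /cyls -bigcup_seq; exists (mkseq x n) => /=; last first.
    by apply/cylP; rewrite size_mkseq.
  rewrite !mem_filter hB//= mem_words size_mkseq eqxx andbT.
  by apply/asboolP; exists x.
- apply: (le_trans (measureU2 mu mB (measurable_cyls _))).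
  have -> : e = e / 2 + e / 2 by lra.
  rewrite EFinD; apply: leeD; first exact: ltW.
  apply: (le_trans (mu_cyls_le muE _)); rewrite lee_fin.
  have h1 : \sum_(w <- l') mass w <= (size l)%:R * 2 `^ (- (n%:R * s')).
    apply: (@le_trans _ _ ((size l')%:R * 2 `^ (- (n%:R * s')))).
      rewrite -lerN2 -mulrN -sumrN; apply: size_mul_le_sum => w.
      by rewrite mem_filter lerN2 => /andP[].
    by rewrite ler_wpM2r ?powR_ge0// ler_nat size_filter count_size.
  apply: (le_trans h1).
  have -> : 2 `^ (- (n%:R * s')) = 2 `^ (- (n%:R * s)) * 2 `^ (- (n%:R * (s' - s))) :> R.
    by rewrite -powRD ?pnatr_eq0 ?implybT//; congr powR; ring.
  rewrite mulrA; apply: (@le_trans _ _ ((M + 1) * (e / 2 / (M + 1)))).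
    by apply: ler_pM; rewrite ?mulr_ge0 ?powR_ge0//; [lra|exact: hN1].
  by rewrite mulrC divfK// gt_eqF//; lra.
Qed.

(** A finite packing measure gives a countable cover by pieces of finite premeasure; the [i]-th is
    enclosed in a set of measure at most [e / 2 ^ i.+1]. *)
Lemma packing_fin_null (s s' : R) (E : set KM) : 0 < s -> s < s' ->
  (forall (eta : R) N, 0 < eta -> exists n (B : set KM), [/\ (N <= n)%N, measurable B,
     (mu B < eta%:E)%E & forall x, ~ B x -> mass (mkseq x n) <= 2 `^ (- (n%:R * s'))]) ->
  measurable E -> (packing s E < +oo)%E -> mu E = 0%E.
Proof.
move=> s0 ss hmu mE /ereal_inf_lt[_ [F EF <-] Ffin].
apply/eqP; rewrite eq_le measure_ge0 andbT; apply/lee_addgt0Pr => e e0; rewrite add0e.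
have Fi i : (packing_pre s (F i) < +oo)%E.
  apply: le_lt_trans Ffin; apply: (le_trans _ (nneseries_lim_ge i.+1 _)); last first.
    by move=> j _ _; exact: packing_pre_ge0.
  by rewrite big_nat_recr//= leeDr// sume_ge0// => j _; exact: packing_pre_ge0.
have /choice[C hC] i : exists C : set KM,
    [/\ measurable C, F i `<=` C & (mu C <= (e / (2 ^ i.+1)%:R)%:E)%E].
  apply: (packing_pre_null s0 ss hmu (Fi i)); rewrite divr_gt0// ltr0n expn_gt0//.
apply: (@le_trans _ _ (\sum_(i <oo) mu (C i))%E).
  apply: measure_sigma_subadditive => //; first by move=> i; case: (hC i).
  by move=> x /EF[i _ Fx]; exists i => //; case: (hC i) => _ h _; exact: h.
have := @epsilon_trick R (fun=> 0%E) e xpredT (fun=> lexx _) (ltW e0).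
rewrite [X in (_ <= X + _)%E]eseries0// add0e; apply: le_trans.
apply: lee_nneseries => [i _ _|i _]; first exact: measure_ge0.
by rewrite /= add0e; case: (hC i).
Qed.

End Dimensions.

(** * Dimensions as rates of entropy *)

Section Rates.
Context {R : realType}.
Implicit Types H : nat -> R.

(** [ln 2] converts nats to bits; the product form avoids dividing by [n = 0]. *)
Definition lower_set H : set R :=
  [set s | exists N, forall n, (N <= n)%N -> n%:R * (s * ln 2) <= H n].

Definition upper_set H : set R :=
  [set s | exists N, forall n, (N <= n)%N -> H n <= n%:R * (s * ln 2)].

(* The lower and upper limits of [H n / (n * ln 2)]. *)
Definition lower_rate H : R := sup (lower_set H).
Definition upper_rate H : R := inf (upper_set H).

Lemma ln2_gt0 : 0 < ln 2 :> R. Proof. by rewrite ln_gt0// ltr1n. Qed.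

Section Bounded.
Variable H : nat -> R.
Hypothesis H04 : forall n, 0 <= H n <= n%:R * 4.

Lemma lower_set0 : lower_set H 0.
Proof. by exists 0%N => n _; rewrite mul0r mulr0; case/andP: (H04 n). Qed.

Lemma lower_set_ub : ubound (lower_set H) (4 / ln 2).
Proof.
move=> s [N /(_ N.+1 (leqnSn _)) h]; rewrite ler_pdivlMr ?ln2_gt0//.
by rewrite -(@ler_pM2l _ N.+1%:R)// (le_trans h)//; case/andP: (H04 N.+1).
Qed.

Lemma upper_set_lb : lbound (upper_set H) 0.
Proof.
move=> s [N /(_ N.+1 (leqnSn _)) h].
have : 0 <= N.+1%:R * (s * ln 2) by apply: le_trans h; case/andP: (H04 N.+1).
by rewrite pmulr_rge0// pmulr_lge0// ln2_gt0.
Qed.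

Lemma upper_set_nonempty : upper_set H (4 / ln 2).
Proof.
by exists 0%N => n _; rewrite divfK ?gt_eqF ?ln2_gt0//; case/andP: (H04 n).
Qed.

Lemma has_sup_lower : has_sup (lower_set H).
Proof. by split; [exists 0; exact: lower_set0|exists (4 / ln 2); exact: lower_set_ub]. Qed.

Lemma has_inf_upper : has_inf (upper_set H).
Proof. by split; [exists (4 / ln 2); exact: upper_set_nonempty|exists 0; exact: upper_set_lb]. Qed.

Lemma lower_rate_ge0 : 0 <= lower_rate H.
Proof. exact: (ub_le_sup has_sup_lower.2 lower_set0). Qed.

Lemma upper_rate_ge0 : 0 <= upper_rate H.
Proof. exact: lb_le_inf has_inf_upper.1 upper_set_lb. Qed.

Lemma lower_rate_eventually t : t < lower_rate H -> exists2 s, t < s & lower_set H s.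
Proof.
move=> tl; have e0 : 0 < lower_rate H - t by lra.
by have [s Ls] := sup_adherent e0 has_sup_lower; rewrite subKr; exists s.
Qed.

Lemma upper_rate_eventually t : upper_rate H < t -> exists2 s, s < t & upper_set H s.
Proof.
move=> tl; have e0 : 0 < t - upper_rate H by lra.
by have [s Us] := inf_adherent e0 has_inf_upper; rewrite addrC subrK; exists s.
Qed.

Lemma lower_rate_frequently s N : lower_rate H < s ->
  exists2 n, (N <= n)%N & H n <= n%:R * (s * ln 2).
Proof.
move=> ls; have : ~ lower_set H s by move=> /(ub_le_sup has_sup_lower.2); rewrite leNgt ls.
move=> ns; apply: contrapT => hn; apply: ns; exists N => n Nn.
by rewrite leNgt; apply/negP => /ltW h; apply: hn; exists n.
Qed.

Lemma upper_rate_frequently s N : s < upper_rate H ->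
  exists2 n, (N <= n)%N & n%:R * (s * ln 2) <= H n.
Proof.
move=> ls; have : ~ upper_set H s by move=> /(ge_inf has_inf_upper.2); rewrite leNgt ls.
move=> ns; apply: contrapT => hn; apply: ns; exists N => n Nn.
by rewrite leNgt; apply/negP => /ltW h; apply: hn; exists n.
Qed.

End Bounded.

Lemma lower_rate_close H H' (c : R) :
  (forall n, 0 <= H n <= n%:R * 4) -> (forall n, 0 <= H' n <= n%:R * 4) ->
  (forall n, `|H n - H' n| <= n%:R * (c * ln 2)) -> lower_rate H <= lower_rate H' + c.
Proof.
move=> h h' hc; apply: ge_sup; first by exists 0; exact: lower_set0.
move=> s [N hN]; rewrite -lerBlDr; apply: (ub_le_sup (has_sup_lower h').2).
by exists N => n /hN; have := hc n; rewrite ler_norml; lra.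
Qed.

Lemma upper_rate_close H H' (c : R) :
  (forall n, 0 <= H n <= n%:R * 4) -> (forall n, 0 <= H' n <= n%:R * 4) ->
  (forall n, `|H n - H' n| <= n%:R * (c * ln 2)) -> upper_rate H <= upper_rate H' + c.
Proof.
move=> h h' hc; rewrite -lerBlDr; apply: lb_le_inf.
  by exists (4 / ln 2); exact: upper_set_nonempty.
move=> s [N hN]; rewrite lerBlDr; apply: (ge_inf (has_inf_upper h).2).
by exists N => n /hN; have := hc n; rewrite ler_norml; lra.
Qed.

End Rates.

(** * Entropy formulas for the two dimensions *)

Section MarkovDimensions.
Context {R : realType}.
Variables (p q : nat -> R) (mu : {measure set KM -> \bar R}).
Hypothesis p01 : forall n, 0 <= p n <= 1.
Hypothesis q01 : forall n, 0 <= q n <= 1.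
Hypothesis muE : is_markov_measure p q mu.

Local Notation H := (mean p q 0 1).

Lemma mean_rate_bounds n : 0 <= H n <= n%:R * 4.
Proof. by rewrite mean_ge0 ?mean_le// ler01 lexx. Qed.

Lemma mu_setD_gt0 (A B : set KM) : measurable A -> measurable B -> (mu B < mu A)%E ->
  (0 < mu (A `\` B))%E.
Proof.
move=> mA mB BA; rewrite lt0e measure_ge0 andbT; apply/negP => /eqP h.
move: BA; rewrite ltNge => /negP; apply.
rewrite (measureDI mu mA mB) [X in (X + _)%E]h add0e.
by apply: mu_le => //; exact: measurableI.
Qed.

Lemma lower_dimH_rate : lower_dimH mu = (lower_rate H)%:E.
Proof.
apply/eqP; rewrite eq_le; apply/andP; split.
  apply/lee_addgt0Pr => e e0; rewrite -EFinD.
  set l := lower_rate H; have l0 : 0 <= l := lower_rate_ge0 mean_rate_bounds.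
  (* Upper bound: [H] has rate below [l + e / 3] for infinitely many [n]. For each [k] one such [n]
     is chosen, with exceptional sets of total measure at most 1/2; the complement of their union
     has dimension at most [l + e]. *)
  have /choice[nB hnB] k : exists nB : nat * set KM,
      [/\ (k <= nB.1)%N, measurable nB.2, (mu nB.2 <= (2^-1 / (2 ^ k.+1)%:R)%:E)%E &
      forall x, ~ nB.2 x -> 2 `^ (- (nB.1%:R * (l + e / 2))) <= markov_mass p q (mkseq x nB.1)].
    have [||N hN] := @mass_ge_in_probability _ _ _ _ p01 q01 muE (l + e / 2) (l + e / 3)
      (2^-1 / (2 ^ k.+1)%:R); first by lra.
      by rewrite divr_gt0// ltr0n expn_gt0.
    have [|n nN Hn] := @lower_rate_frequently _ _ mean_rate_bounds (l + e / 3) (maxn k N).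
      by rewrite /l; lra.
    have /andP[kn Nn] : (k <= n)%N && (N <= n)%N by rewrite -geq_max.
    by have [B [mB /ltW muB hB]] := hN n Nn Hn; exists (n, B).
  pose B := \bigcup_k (nB k).2.
  have mB : measurable B by apply: bigcup_measurable => k _; case: (hnB k).
  have muB : (mu B <= (2^-1)%:E)%E.
    apply: (@le_trans _ _ (\sum_(k <oo) mu (nB k).2)%E).
      by apply: measure_sigma_subadditive => // k; case: (hnB k).
    have h2 : 0 <= 2^-1 :> R by rewrite invr_ge0.
    have := @epsilon_trick R (fun=> 0%E) (2^-1) xpredT (fun=> lexx _) h2.
    rewrite [X in (_ <= X + _)%E]eseries0// add0e; apply: le_trans.
    apply: lee_nneseries => [i _ _|i _]; first exact: measure_ge0.
    by rewrite /= add0e; case: (hnB i).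
  have mD : measurable (setT `\` B) by exact: measurableD.
  apply: ge_ereal_inf; exists (dimH R (setT `\` B)).
    exists (setT `\` B) => //; split=> //; apply: mu_setD_gt0 => //.
    apply: (le_lt_trans muB).
    have -> : mu setT = 1%:E by exact: mu_setT muE.
    by rewrite lte_fin invf_lt1// ltr1n.
  apply: dimH_le; first by lra.
  apply: (@hausdorff_eq0 _ p q p01 q01 _ (l + e / 2)); [lra|lra|] => N.
  have [Nn _ _ hx] := hnB N; exists (nB N).1 => // x [_ Bx]; apply: hx => Bx'.
  by apply: Bx; exists N.
apply: le_ereal_inf_tmp => _ [E [mE muE0] <-].
apply: le_ereal_inf_tmp => _ [t [t0 ht] <-]; rewrite lee_fin leNgt; apply/negP => tl.
(* Lower bound: if [t] is below the rate, the mass is eventually small outside some [B] with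
   [mu B < mu E], and the mass distribution principle makes the [t]-measure of [E] positive. *)
have [s1 ts1 [N0 hN0]] := lower_rate_eventually mean_rate_bounds tl.
have muEf := mu_fin_num muE mE.
have [|||N [B [mB muB hB]]] := @mass_le_eventually _ _ _ _ p01 q01 muE t s1 (fine (mu E)) N0.
- by rewrite (ltW t0).
- by rewrite -lte_fin fineK.
- exact: hN0.
rewrite fineK// in muB.
have := mu_setD_gt0 mE mB muB; apply/negP; rewrite -leNgt -ht.
apply: (@mass_distribution _ p q mu muE _ N) => //; first exact: measurableD.
by move=> x [_ Bx]; exact: hB.
Qed.

Lemma lower_dimP_rate : lower_dimP mu = (upper_rate H)%:E.
Proof.
set l := upper_rate H; have l0 : 0 <= l := upper_rate_ge0 mean_rate_bounds.
apply/eqP; rewrite eq_le; apply/andP; split.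
  apply/lee_addgt0Pr => e e0; rewrite -EFinD.
  have [|s1 s1l [N0 hN0]] := @upper_rate_eventually _ _ mean_rate_bounds (l + e / 2).
    by rewrite /l; lra.
  have s10 : 0 <= s1 by apply: (upper_set_lb mean_rate_bounds); exists N0.
  (* An exceptional set of measure below 1 is enough: its complement has positive measure. *)
  have [|||N [B [mB muB hB]]] := @mass_ge_eventually _ _ _ _ p01 q01 muE (l + e / 2) s1 1 N0.
  - by rewrite s10.
  - exact: ltr01.
  - exact: hN0.
  have mD : measurable (setT `\` B) by exact: measurableD.
  apply: ge_ereal_inf; exists (dimP R (setT `\` B)).
    exists (setT `\` B) => //; split=> //; apply: mu_setD_gt0 => //.
    by have -> : mu setT = 1%:E by exact: mu_setT muE.
  apply: dimP_le; first by lra.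
  apply: (@packing_eq0 _ p q mu muE _ (l + e / 2) N); [lra|lra|].
  by move=> x [_ Bx]; exact: hB.
apply: le_ereal_inf_tmp => _ [E [mE muE0] <-].
apply: le_ereal_inf_tmp => _ [t [t0 ht] <-]; rewrite lee_fin leNgt; apply/negP => tl.
have : mu E = 0%E; last by apply/eqP; rewrite gt_eqF.
(* Thirds leave two rates strictly between [t] and [l]: one for the mass bound, a larger one for the
   entropy along infinitely many [n]. *)
have tl0 : 0 < (l - t) / 3 by rewrite divr_gt0//; lra.
apply: (@packing_fin_null _ p q mu muE t (t + (l - t) / 3)) => //; first by lra.
  move=> eta N eta0.
  have [|N1 hN1] := @mass_le_in_probability _ _ _ _ p01 q01 muE (t + (l - t) / 3)
    (t + (l - t) / 3 + (l - t) / 3) eta _ eta0; first by lra.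
  have [|n nN Hn] := @upper_rate_frequently _ _ mean_rate_bounds
    (t + (l - t) / 3 + (l - t) / 3) (maxn N N1); first by rewrite -/l; lra.
  have /andP[Nn N1n] : (N <= n)%N && (N1 <= n)%N by rewrite -geq_max.
  by have [B [mB muB hB]] := hN1 n N1n Hn; exists n, B.
by rewrite ht ltry.
Qed.

End MarkovDimensions.

(** * Uniform continuity of the dimensions in the weights *)

Unset Implicit Arguments.

Theorem theorem2 (R : realType) (eps : R) : 0 < eps ->
  exists zeta : R, 0 < zeta /\
  forall (p q p' q' : nat -> R) (mu mu' : {measure set KM -> \bar R}),
    (forall n, 0 <= p n <= 1) -> (forall n, 0 <= q n <= 1) ->
    (forall n, 0 <= p' n <= 1) -> (forall n, 0 <= q' n <= 1) ->
    (exists c : R, c < zeta /\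
       forall n, Num.max `|p n - p' n| `|q n - q' n| <= c) ->
    is_markov_measure p q mu -> is_markov_measure p' q' mu' ->
    (`| lower_dimH mu - lower_dimH mu' | < eps%:E)%E /\
    (`| lower_dimP mu - lower_dimP mu' | < eps%:E)%E.
Proof.
move=> eps0; have l2 := @ln2_gt0 R.
(* Chosen so that [9 * z = eps / 2 * ln 2]: the rates then differ by at most [eps / 2], which leaves
   room for the strict inequality. *)
pose z := eps / 2 * ln 2 / 9.
have z0 : 0 < z by rewrite !(divr_gt0, mulr_gt0).
exists (z ^+ 2); split; first by rewrite exprn_gt0.
move=> p q p' q' mu mu' p01 q01 p'01 q'01 [c [cz hc]] muE mu'E.
have pz n : `|p n - p' n| <= z ^+ 2.
  by apply: (le_trans _ (ltW cz)); apply: le_trans (hc n); rewrite le_max lexx.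
have qz n : `|q n - q' n| <= z ^+ 2.
  by apply: (le_trans _ (ltW cz)); apply: le_trans (hc n); rewrite le_max lexx orbT.
have H04 := mean_rate_bounds p01 q01; have H'04 := mean_rate_bounds p'01 q'01.
have close n : `|mean p q 0 1 n - mean p' q' 0 1 n| <= n%:R * (eps / 2 * ln 2).
  (* Both chains start from the same law, so the term [4 / z * |u - u'|] vanishes. *)
  have := mean_compare z0 p01 q01 p'01 q'01 pz qz n 0 (u := 1) (u' := 1).
  rewrite ler01 lexx => /(_ isT isT) /le_trans; apply.
  by rewrite subrr normr0 mulr0 add0r /z; lra.
have close' n : `|mean p' q' 0 1 n - mean p q 0 1 n| <= n%:R * (eps / 2 * ln 2).
  by rewrite distrC.
rewrite (lower_dimH_rate p01 q01 muE) (lower_dimH_rate p'01 q'01 mu'E).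
rewrite (lower_dimP_rate p01 q01 muE) (lower_dimP_rate p'01 q'01 mu'E).
rewrite -!EFinB !abse_EFin !lte_fin !ltr_norml.
have := lower_rate_close H04 H'04 close; have := lower_rate_close H'04 H04 close'.
have := upper_rate_close H04 H'04 close; have := upper_rate_close H'04 H04 close'.
by move=> *; split; apply/andP; split; lra.
Qed.
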